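(* Let $m>3$ be a square-free integer such that the ideal class group $Cl(K)$ of $K=\mathbb{Q}(\sqrt{-m})$ contains an element of order greater than $2$, and let $\beta:L\to\mathcal{P}_m$ be the map constructed in the context (for any choices made in that construction). Then $\mathcal{P}_m$ is a free abelian group and the image $\beta(L)$ is a basis of $\mathcal{P}_m$.
   Context: Let $m>3$ be a fixed square-free integer. A triple $(a,b,c)\in\mathbb{Z}\times\mathbb{Z}\times\mathbb{N}$ with $a^2+mb^2=c^2$ is primitive if $\gcd(a,b,c)=1$. Two such triples $(a,b,c)$, $(A,B,C)$ (not necessarily primitive) are equivalent if there are nonzero integers $s,t$ with $s(a,b,c)=t(A,B,C)$, where $s(a,b,c)=(sa,sb,|sc|)$; the class of $(a,b,c)$ is denoted $[a,b,c]$. The set $\mathcal{P}_m$ of classes is an abelian group under $[a,b,c]+[A,B,C]=[aA-mbB,\,aB+bA,\,cC]$, with identity $[1,0,1]$. Let $K=\mathbb{Q}(\sqrt{-m})$, $\mathcal{O}_K$ its ring of integers, $Cl(K)$ its class group, $N$ the ideal norm, $\mathbb{P}$ the set of rational primes, $P(\mathcal{O}_K)$ the set of nonzero prime ideals, $\mu:P(\mathcal{O}_K)\to\mathbb{P}$ the map to the prime below, $\pi:P(\mathcal{O}_K)\to Cl(K)$ the class map. For an ideal $Q$, $Q'$ denotes its conjugate. Fix a lifting $l:\mathbb{P}\to P(\mathcal{O}_K)$ with $\mu\circ l=\mathrm{id}$, and put $f=\pi\circ l$. Let $E=\{x\in Cl(K):x^2=1\}$, $\rho:Cl(K)\to Cl(K)/E$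 the projection. Let $L$ be the set of primes $p$ with Kronecker symbol $\left(\frac{-m}{p}\right)=1$ (for $p=2$ this means $-m\equiv1\pmod 8$), and $L_0=f^{-1}(E)\cap L$. Let $\delta=0$ if $-m\equiv1\pmod4$ and $\delta=1$ otherwise (so every element of $\mathcal{O}_K$ has the form $(u+v\sqrt{-m})/2^{1-\delta}$ with $u,v\in\mathbb{Z}$). Write $Cl(K)/E\cong G_1\times\cdots\times G_n$ with $G_j$ cyclic of order $h_j$, and choose prime ideals $P_1,\dots,P_n$ such that $\rho\pi(P_j)$ generates $G_j$; let $p_j=\mu(P_j)$. Define $\beta:L\to\mathcal{P}_m$ as follows. (i) If $p\in L_0$: $\beta(p)=[a,b,p]$ where $a,b$ are positive integers with $a^2+mb^2=p^2$, or $\beta(p)=[a,b,2p]$ where $a,b$ are positive integers with $a^2+mb^2=(2p)^2$. (ii) If $p=p_j$ for some $j$: write $P_j^{2h_j}=\langle (u+v\sqrt{-m})/2^{1-\delta}\rangle$ with $u,v\in\mathbb{Z}$ (then $u^2+mv^2=(2^{1-\delta}p^{h_j})^2$), and set $\beta(p)=[|u|,|v|,2^{1-\delta}p^{h_j}]$. (iii) Otherwise: consider all ideals $J=l(p)\,Q_1^{a_{1}}\cdots Q_n^{a_{n}}$ with $Q_j\in\{P_j,P_j'\}$ and $a_j\in\{0,1,\dots,\lfloor h_j/2\rfloor\}$ such that the class of $J$ lies in $E$; for each such $J$ write $J^2=\langle (u+v\sqrt{-m})/2^{1-\delta}\rangle$, giving $u^2+mv^2=(2^{1-\delta}\,p\,p_1^{a_1}\cdots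 p_n^{a_n})^2$. Among the resulting primitive triples $(u,v,2^{1-\delta}p\,p_1^{a_1}\cdots p_n^{a_n})$ take one with the smallest value $|u|=u_0$, with corresponding $|v|=v_0$, and set $\beta(p)=[u_0,v_0,2^{1-\delta}p\,p_1^{a_1}\cdots p_n^{a_n}]$. *)

(* Defs.v *)
From HB Require Import structures.
From mathcomp Require Import all_boot all_order all_algebra all_field.
From mathcomp Require Import generic_quotient ring_quotient.
From mathcomp Require Import boolp classical_sets.
From mathcomp Require Import ring zify.

Set Implicit Arguments.
Unset Strict Implicit.
Unset Printing Implicit Defensive.

Import Order.TTheory GRing.Theory Num.Theory.
Local Open Scope ring_scope.
Local Open Scope classical_set_scope.
Local Open Scope quotient_scope.

Section AbelianGroups.
Variable V : zmodType.

Definition has_order (x : V) (k : nat) : Prop :=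
  [/\ (0 < k)%N, x *+ k = 0 & forall i, (0 < i < k)%N -> x *+ i <> 0].

Definition cycle_of (x : V) : set V := [set x *~ k | k in [set: int]].

Definition cyclic_of_order (G : set V) (k : nat) : Prop :=
  exists2 g, G = cycle_of g & has_order g k.

Definition internal_direct_product (n : nat) (G : 'I_n -> set V) : Prop :=
  forall x : V, exists! y : {ffun 'I_n -> V},
    (forall j, G j (y j)) /\ x = \sum_j y j.

Definition is_basis (B : set V) : Prop :=
  (forall (s : seq V) (k : V -> int), uniq s -> (forall x, x \in s -> B x) ->
     \sum_(x <- s) x *~ k x = 0 -> forall x, x \in s -> k x = 0)
  /\ (forall v : V, exists (s : seq V) (k : V -> int),
     [/\ uniq s, forall x, x \in s -> B x & v = \sum_(x <- s) x *~ k x]).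

Definition free_abelian_group : Prop := exists B : set V, is_basis B.

Definition two_torsion : {pred V} := [pred x | x *+ 2 == 0].

Lemma two_torsion_zmod_closed : zmod_closed two_torsion.
Proof.
split=> [|x y]; rewrite !inE ?mul0rn // => /eqP x2 /eqP y2.
by rewrite mulrnBl x2 y2 subr0.
Qed.

HB.instance Definition _ :=
  GRing.isZmodClosed.Build V two_torsion two_torsion_zmod_closed.

End AbelianGroups.

Arguments two_torsion V : clear implicits.
Arguments free_abelian_group V : clear implicits.

Definition square_free (m : nat) : Prop :=
  forall d : nat, (d ^ 2 %| m)%N -> d = 1%N.

Section PythagoreanGroup.
Variable m : nat.

(* Triples are required to have c > 0: this only discards (0, 0, 0). *)
Definition is_ptriple (t : int * int * nat) : bool :=
  (t.1.1 ^+ 2 + m%:Z * t.1.2 ^+ 2 == t.2%:Z ^+ 2) && (0 < t.2)%N.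

Record ptriple := PTriple {
  ptriple_val :> int * int * nat;
  ptripleP : is_ptriple ptriple_val }.

HB.instance Definition _ := [isSub for ptriple_val].
HB.instance Definition _ := [Choice of ptriple by <:].

Definition primitive (t : int * int * nat) : Prop :=
  gcdz (gcdz t.1.1 t.1.2) t.2%:Z = 1.

Definition scale_triple (s : int) (t : int * int * nat) : int * int * nat :=
  (s * t.1.1, s * t.1.2, absz (s * t.2%:Z)).

Definition ptriple_equiv (x y : ptriple) : bool :=
  `[< exists s t : int,
        [/\ s <> 0, t <> 0 & scale_triple s x = scale_triple t y] >].

Lemma scale_tripleM s t x :
  scale_triple (s * t) x = scale_triple s (scale_triple t x).
Proof. by rewrite /scale_triple /= !mulrA !abszM absz_nat mulnA. Qed.

Lemma ptriple_equiv_is_equiv : equiv_class_of ptriple_equiv.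
Proof.
split=> [x|x y|y x z].
- by apply/asboolP; exists 1, 1.
- by apply/asboolP/asboolP => -[s [t [? ? e]]]; exists t, s; split.
- move=> /asboolP[s [t [s0 t0 e]]] /asboolP[s' [t' [s'0 t'0 e']]].
  apply/asboolP; exists (s' * s), (t * t'); split.
  + by apply/eqP; rewrite mulf_neq0 //; apply/eqP.
  + by apply/eqP; rewrite mulf_neq0 //; apply/eqP.
  + by rewrite scale_tripleM e -scale_tripleM mulrC !scale_tripleM e'.
Qed.

Canonical ptriple_equiv_rel := EquivRelPack ptriple_equiv_is_equiv.
Canonical ptriple_encModRel := defaultEncModRel ptriple_equiv.

Definition pyth_group := {eq_quot ptriple_equiv}.
HB.instance Definition _ : EqQuotient _ ptriple_equiv pyth_group :=
  EqQuotient.on pyth_group.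
HB.instance Definition _ := Choice.on pyth_group.

Definition add_triple (x y : int * int * nat) : int * int * nat :=
  (x.1.1 * y.1.1 - m%:Z * x.1.2 * y.1.2, x.1.1 * y.1.2 + x.1.2 * y.1.1,
   (x.2 * y.2)%N).

Lemma add_ptriple_subproof (x y : ptriple) : is_ptriple (add_triple x y).
Proof.
case: x y => [[[a b] c] /andP[/= /eqP e c0]] [[[A B] C] /andP[/= /eqP E C0]].
rewrite /is_ptriple /= muln_gt0 c0 C0 !andbT PoszM exprMn -e -E.
by apply/eqP; ring.
Qed.
Definition add_ptriple x y := PTriple (add_ptriple_subproof x y).

Definition opp_triple (x : int * int * nat) : int * int * nat :=
  (x.1.1, - x.1.2, x.2).
Lemma opp_ptriple_subproof (x : ptriple) : is_ptriple (opp_triple x).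
Proof. by rewrite /is_ptriple /= sqrrN; case: x. Qed.
Definition opp_ptriple x := PTriple (opp_ptriple_subproof x).

Lemma one_ptriple_subproof : is_ptriple (1, 0, 1%N).
Proof. by rewrite /is_ptriple /= expr0n mulr0 addr0. Qed.
Definition one_ptriple := PTriple one_ptriple_subproof.

Lemma scale_add_triple s t x y :
  scale_triple (s * t) (add_triple x y)
  = add_triple (scale_triple s x) (scale_triple t y).
Proof.
rewrite /scale_triple /add_triple /= PoszM.
by congr (_, _, _); [ring|ring|rewrite -abszM; congr absz; ring].
Qed.

Lemma scale_opp_triple s x :
  scale_triple s (opp_triple x) = opp_triple (scale_triple s x).
Proof. by rewrite /scale_triple /opp_triple /= mulrN. Qed.

Definition pyth_zero : pyth_group := lift_cst pyth_group one_ptriple.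
Definition pyth_add := lift_op2 pyth_group add_ptriple.
Definition pyth_opp := lift_op1 pyth_group opp_ptriple.

Canonical pi_pyth_zero_morph := PiConst pyth_zero.

Lemma pi_pyth_opp : {morph \pi : x / opp_ptriple x >-> pyth_opp x}.
Proof.
move=> x; unlock pyth_opp; apply/eqP; rewrite piE.
have: x = repr (\pi_pyth_group x) %[mod pyth_group] by rewrite reprK.
move=> /eqP; rewrite piE => /asboolP[s [t [s0 t0 e]]].
by apply/asboolP; exists s, t; split=> //; rewrite !scale_opp_triple e.
Qed.
Canonical pi_pyth_opp_morph := PiMorph1 pi_pyth_opp.

Lemma pi_pyth_add : {morph \pi : x y / add_ptriple x y >-> pyth_add x y}.
Proof.
move=> x y; unlock pyth_add; apply/eqP; rewrite piE.
have: x = repr (\pi_pyth_group x) %[mod pyth_group] by rewrite reprK.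
move=> /eqP; rewrite piE => /asboolP[s [t [s0 t0 e]]].
have: y = repr (\pi_pyth_group y) %[mod pyth_group] by rewrite reprK.
move=> /eqP; rewrite piE => /asboolP[s' [t' [s'0 t'0 e']]].
apply/asboolP; exists (s * s'), (t * t'); split.
- by apply/eqP; rewrite mulf_neq0 //; apply/eqP.
- by apply/eqP; rewrite mulf_neq0 //; apply/eqP.
- by rewrite !scale_add_triple e e'.
Qed.
Canonical pi_pyth_add_morph := PiMorph2 pi_pyth_add.

Lemma pyth_addA : associative pyth_add.
Proof.
elim/quotW=> x; elim/quotW=> y; elim/quotW=> z; rewrite !piE.
congr (\pi_pyth_group _); apply: val_inj; rewrite /= /add_triple /=.
by congr (_, _, _); [ring|ring|rewrite mulnA].
Qed.

Lemma pyth_addC : commutative pyth_add.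
Proof.
elim/quotW=> x; elim/quotW=> y; rewrite !piE.
congr (\pi_pyth_group _); apply: val_inj; rewrite /= /add_triple /=.
by congr (_, _, _); [ring|ring|rewrite mulnC].
Qed.

Lemma pyth_add0 : left_id pyth_zero pyth_add.
Proof.
elim/quotW=> x; rewrite !piE.
congr (\pi_pyth_group _); apply: val_inj; case: x => [[[a b] c] e].
by rewrite /= /add_triple /=; congr (_, _, _); [ring|ring|rewrite mul1n].
Qed.

Lemma pyth_addN : left_inverse pyth_zero pyth_opp pyth_add.
Proof.
elim/quotW=> x; rewrite !piE; apply/eqP; rewrite piE.
apply/asboolP; exists 1, (x.2%:Z ^+ 2).
case: x => [[[a b] c] /andP[/= /eqP e c0]]; split=> //.
  by apply/eqP; rewrite expf_eq0 /=; lia.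
rewrite /scale_triple /add_triple /opp_triple /=; congr (_, _, _); last by lia.
- by rewrite -e; ring.
- by ring.
Qed.

HB.instance Definition _ := GRing.isZmodule.Build pyth_group
  pyth_addA pyth_addC pyth_add0 pyth_addN.

(* x = [a, b, c]; in particular a^2 + m b^2 = c^2 with c > 0. *)
Definition is_class (x : pyth_group) (a b : int) (c : nat) : Prop :=
  exists2 t : ptriple, ptriple_val t = (a, b, c) & x = \pi_pyth_group t.

End PythagoreanGroup.

Section QuadraticField.
Variable m : nat.

Definition sqrt_neg : algC := sqrtC (- m%:R).

Definition quadratic_field : set algC :=
  [set x | exists a b : rat, x = ratr a + ratr b * sqrt_neg].

Definition ring_of_integers : set algC :=
  [set x | quadratic_field x /\ x \in Aint].

Local Notation OK := ring_of_integers.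

Lemma sqrt_neg_sqr : sqrt_neg * sqrt_neg = - m%:R.
Proof. by rewrite -expr2 sqrtCK. Qed.

Lemma conj_sqrt_neg : sqrt_neg^* = - sqrt_neg.
Proof.
have e : sqrt_neg^* ^+ 2 = sqrt_neg ^+ 2.
  by rewrite -rmorphXn /= sqrtCK rmorphN /= conjC_nat.
move/eqP: e; rewrite eqf_sqr => /orP[/eqP/CrealP s_real|/eqP //].
have : 0 <= sqrt_neg ^+ 2 by rewrite real_exprn_even_ge0.
rewrite sqrtCK oppr_ge0 => m_le0.
have : sqrt_neg = 0.
  apply/eqP; rewrite sqrtC_eq0 oppr_eq0; apply/eqP/le_anti.
  by rewrite m_le0 ler0n.
by move=> ->; rewrite rmorph0 oppr0.
Qed.

Lemma KD x y :
  quadratic_field x -> quadratic_field y -> quadratic_field (x + y).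
Proof.
move=> [a [b ->]] [c [d ->]]; exists (a + c), (b + d).
by rewrite !rmorphD /=; ring.
Qed.

Lemma KM x y :
  quadratic_field x -> quadratic_field y -> quadratic_field (x * y).
Proof.
move=> [a [b ->]] [c [d ->]]; exists (a * c - m%:R * b * d), (a * d + b * c).
rewrite !rmorphD rmorphN !rmorphM /= ratr_nat.
have e := sqrt_neg_sqr; ring: e.
Qed.

Lemma Krat (a : rat) : quadratic_field (ratr a).
Proof. by exists a, 0; rewrite rmorph0 mul0r addr0. Qed.

Lemma conj_ratr (a : rat) : (ratr a : algC)^* = ratr a.
Proof. by rewrite conj_Crat ?Crat_rat. Qed.

Lemma conj_elt (a b : rat) :
  (ratr a + ratr b * sqrt_neg)^* = ratr a - ratr b * sqrt_neg.
Proof.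
by rewrite rmorphD (rmorphM _ (ratr b)) /= !conj_ratr conj_sqrt_neg mulrN.
Qed.

Lemma Kconj x : quadratic_field x -> quadratic_field x^*.
Proof.
move=> [a [b ->]]; exists a, (- b).
by rewrite conj_elt rmorphN /= mulNr.
Qed.

Lemma OKD x y : OK x -> OK y -> OK (x + y).
Proof. by move=> [? ?] [? ?]; split; [exact: KD|exact: rpredD]. Qed.
Lemma OKM x y : OK x -> OK y -> OK (x * y).
Proof. by move=> [? ?] [? ?]; split; [exact: KM|exact: rpredM]. Qed.
Lemma OKint (z : int) : OK z%:~R.
Proof. by split; [rewrite -ratr_int; exact: Krat|exact: Aint_int]. Qed.
Lemma OK0 : OK 0. Proof. exact: (OKint 0). Qed.
Lemma OK1 : OK 1. Proof. exact: (OKint 1). Qed.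
Lemma OKnat (k : nat) : OK k%:R. Proof. exact: (OKint k). Qed.
Lemma OKconj x : OK x -> OK x^*.
Proof. by move=> [? ?]; split; [exact: Kconj|rewrite Aint_aut]. Qed.

Lemma OKnorm_int x : OK x -> x * x^* \in Num.int.
Proof.
move=> Ox; apply: Cint_rat_Aint; last by case: (OKM Ox (OKconj Ox)).
case: Ox => -[a [b ->]] _; rewrite conj_elt.
suff -> : (ratr a + ratr b * sqrt_neg) * (ratr a - ratr b * sqrt_neg)
  = ratr (a * a + m%:R * b * b) by exact: Crat_rat.
rewrite rmorphD !rmorphM /= ratr_nat.
have e := sqrt_neg_sqr; ring: e.
Qed.

Record is_ideal (I : set algC) : Prop := IsIdeal {
  ideal_sub : I `<=` OK;
  ideal0 : I 0;
  idealD : forall x y, I x -> I y -> I (x + y);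
  idealM : forall a x, OK a -> I x -> I (a * x) }.

Definition is_nzideal (I : set algC) : Prop :=
  is_ideal I /\ exists2 x, I x & x != 0.

Record nzideal := NzIdeal {
  nzideal_val :> set algC;
  nzidealP : `[< is_nzideal nzideal_val >] }.

HB.instance Definition _ := [isSub for nzideal_val].
HB.instance Definition _ := [Choice of nzideal by <:].

Definition principal (a : algC) : set algC := [set a * x | x in OK].

Definition mul_set (I J : set algC) : set algC :=
  [set x | exists2 s : seq (algC * algC),
     (forall z, z \in s -> I z.1 /\ J z.2) & x = \sum_(z <- s) z.1 * z.2].

Definition conj_set (I : set algC) : set algC := [set x^* | x in I].

Definition scale_set (a : algC) (I : set algC) : set algC :=
  [set a * x | x in I].

Lemma nzideal_inj (I J : nzideal) : nzideal_val I = J -> I = J.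
Proof. exact: val_inj. Qed.

Lemma nzideal_ideal (I : nzideal) : is_ideal I.
Proof. by case: I => I /= /asboolP[]. Qed.

Lemma mul_setP (I J S : set algC) : S 0 ->
  (forall x y, S x -> S y -> S (x + y)) ->
  (forall x y, I x -> J y -> S (x * y)) -> mul_set I J `<=` S.
Proof.
move=> S0 SD SM x [s sIJ ->]; elim: s sIJ => [|z s IHs] sIJ.
  by rewrite big_nil.
rewrite big_cons; apply: SD.
  by case: (sIJ z); rewrite ?mem_head // => ? ?; apply: SM.
by apply: IHs => y ys; apply: sIJ; rewrite inE ys orbT.
Qed.

Lemma mul_set0 I J : mul_set I J 0.
Proof. by exists [::] => //; rewrite big_nil. Qed.

Lemma mul_setD I J x y :
  mul_set I J x -> mul_set I J y -> mul_set I J (x + y).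
Proof.
move=> [s sIJ ->] [t tIJ ->]; exists (s ++ t); last by rewrite big_cat.
by move=> z; rewrite mem_cat => /orP[/sIJ|/tIJ].
Qed.

Lemma mul_setM (I J : set algC) x y : I x -> J y -> mul_set I J (x * y).
Proof.
move=> Ix Jy; exists [:: (x, y)]; last by rewrite big_seq1.
by move=> z; rewrite inE => /eqP ->.
Qed.

Lemma mul_set_ideal I J : is_ideal I -> is_ideal J -> is_ideal (mul_set I J).
Proof.
move=> hI hJ; split.
- apply: mul_setP; [exact: OK0|exact: OKD|] => x y Ix Jy.
  by apply: OKM; [apply: ideal_sub Ix|apply: ideal_sub Jy].
- exact: mul_set0.
- exact: mul_setD.
- move=> a x Oa; move: x; apply: mul_setP.
  + by rewrite /= mulr0; exact: mul_set0.
  + by move=> x y ? ? /=; rewrite mulrDr; exact: mul_setD.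
  + move=> x y Ix Jy /=; rewrite mulrA; apply: mul_setM => //.
    exact: idealM.
Qed.

Lemma mul_nzideal_subproof (I J : nzideal) : `[< is_nzideal (mul_set I J) >].
Proof.
case: I J => [I /= /asboolP[hI [x Ix x0]]] [J /= /asboolP[hJ [y Jy y0]]].
apply/asboolP; split; first exact: mul_set_ideal.
by exists (x * y); [exact: mul_setM|rewrite mulf_neq0].
Qed.
Definition mul_nzideal I J := NzIdeal (mul_nzideal_subproof I J).

Lemma one_nzideal_subproof : `[< is_nzideal OK >].
Proof.
apply/asboolP; split; last by exists 1; [exact: OK1|exact: oner_neq0].
by split=> //; [exact: OK0|exact: OKD|exact: OKM].
Qed.
Definition one_nzideal := NzIdeal one_nzideal_subproof.

Lemma conj_nzideal_subproof (I : nzideal) : `[< is_nzideal (conj_set I) >].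
Proof.
case: I => [I /= /asboolP[hI [x Ix x0]]]; apply/asboolP; split; first split.
- by move=> _ [y Iy <-]; apply: OKconj; apply: ideal_sub Iy.
- by exists 0; [exact: ideal0|rewrite rmorph0].
- move=> _ _ [y Iy <-] [z Iz <-]; exists (y + z); last by rewrite rmorphD.
  exact: idealD.
- move=> a _ Oa [y Iy <-]; exists (a^* * y); last by rewrite rmorphM /= conjCK.
  by apply: idealM => //; exact: OKconj.
- by exists x^*; [exists x|rewrite fmorph_eq0].
Qed.
Definition conj_nzideal I := NzIdeal (conj_nzideal_subproof I).

Lemma mul_nzidealC : commutative mul_nzideal.
Proof.
move=> I J; apply: val_inj; rewrite eqEsubset; split; apply: mul_setP;
  by [exact: mul_set0|exact: mul_setD|move=> *; rewrite mulrC; exact: mul_setM].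
Qed.

Lemma mul_nzidealA : associative mul_nzideal.
Proof.
suff sub (I J K : nzideal) :
    nzideal_val (mul_nzideal I (mul_nzideal J K))
    `<=` mul_nzideal (mul_nzideal I J) K.
  move=> I J K; apply: val_inj; rewrite eqEsubset; split; first exact: sub.
  by have := sub K J I; rewrite mul_nzidealC (mul_nzidealC J)
    (mul_nzidealC _ I) (mul_nzidealC K).
apply: mul_setP; [exact: mul_set0|exact: mul_setD|].
move=> x y Ix; move: y; apply: mul_setP => [|y z|y z Jy Kz] /=.
- by rewrite mulr0; exact: mul_set0.
- by rewrite mulrDr; exact: mul_setD.
- by rewrite mulrA; do 2 apply: mul_setM => //.
Qed.

Lemma mul1_nzideal : left_id one_nzideal mul_nzideal.
Proof.
move=> I; have hI := nzideal_ideal I.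
apply: val_inj; rewrite eqEsubset; split.
  by apply: mul_setP; [exact: ideal0|exact: idealD|exact: idealM].
by move=> x Ix; rewrite -[x]mul1r; apply: mul_setM => //; exact: OK1.
Qed.

Lemma mul_nzideal1 : right_id one_nzideal mul_nzideal.
Proof. by move=> I; rewrite mul_nzidealC mul1_nzideal. Qed.

HB.instance Definition _ := hasMul.Build nzideal mul_nzideal.
HB.instance Definition _ := hasOne.Build nzideal one_nzideal.
HB.instance Definition _ := Magma_isSemigroup.Build nzideal mul_nzidealA.
HB.instance Definition _ :=
  BaseUMagma_isUMagma.Build nzideal mul1_nzideal mul_nzideal1.

Lemma mul_conj_nzideal (I : nzideal) : exists2 n : nat,
  (0 < n)%N & mul_set I (conj_set I) = principal n%:R.
Proof.
have hI := nzideal_ideal I.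
have hM : is_ideal (mul_set I (conj_set I)).
  exact: (nzideal_ideal (mul_nzideal I (conj_nzideal I))).
pose Q k := (0 < k)%N && `[< mul_set I (conj_set I) k%:R >].
have norm_in x : nzideal_val I x -> mul_set I (conj_set I) (x * x^*).
  by move=> Ix; apply: mul_setM => //; exists x.
have exQ : exists k, Q k.
  have [x Ix x0] : exists2 x, nzideal_val I x & x != 0.
    by case: (I) => J /= /asboolP[].
  have /OKnorm_int := ideal_sub hI Ix.
  rewrite -normCK => /intrP[z ez].
  have z0 : 0 < z by rewrite -(ltr0z algC) -ez exprn_gt0 // normr_gt0.
  case: z z0 ez => // k k0 ez; exists k; apply/andP; split; first by lia.
  by apply/asboolP; have := norm_in x Ix; rewrite -normCK ez.
case: (ex_minnP exQ) => n /andP[n0 /asboolP Mn] nmin.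
have n0C : (n%:R : algC) != 0 by rewrite pnatr_eq0 -lt0n.
have dvdn z : mul_set I (conj_set I) z%:~R -> exists w : int, z = n%:Z * w.
  move=> Mz; exists (z %/ n)%Z; rewrite mulrC.
  have: mul_set I (conj_set I) (z %% n)%Z%:~R.
    rewrite /modz rmorphB rmorphM /= -[n%:~R]/(n%:R); apply: idealD => //.
    rewrite -mulNr -rmorphN /=; apply: idealM => //; exact: OKint.
  have r0 : (0 <= z %% n)%Z by rewrite modz_ge0; lia.
  have rn : (z %% n < n)%Z by rewrite ltz_mod; lia.
  rewrite {2}(divz_eq z n); case: (z %% n)%Z r0 rn => // r _ rn Mr.
  case: r rn Mr => [|r] rn Mr; first by rewrite addr0.
  have := nmin r.+1; rewrite /Q /=.
  by move=> /(_ (introT (asboolP _) Mr)); lia.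
exists n => //; rewrite eqEsubset; split; last first.
  by move=> _ [x Ox <-]; rewrite mulrC; exact: idealM.
have nrm x : nzideal_val I x -> exists w : int, x * x^* = n%:R * w%:~R.
  move=> Ix; have Mx := norm_in x Ix.
  have /OKnorm_int/intrP[z ez] := ideal_sub hI Ix.
  move: Mx; rewrite ez => /dvdn[w ->]; exists w; by rewrite rmorphM.
apply: mul_setP.
- by exists 0; [exact: OK0|rewrite mulr0].
- move=> _ _ [x Ox <-] [y Oy <-]; exists (x + y); last by rewrite mulrDr.
  exact: OKD.
move=> x _ Ix [y Iy <-]; exists (n%:R^-1 * (x * y^*)); last by rewrite mulVKf.
have [Ox Oy] := (ideal_sub hI Ix, ideal_sub hI Iy).
have [w1 e1] := nrm x Ix; have [w2 e2] := nrm y Iy.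
have [w3 e3] := nrm _ (idealD hI Ix Iy).
split.
  apply: KM; last by case: (OKM Ox (OKconj Oy)).
  by rewrite -ratr_nat -fmorphV; exact: Krat.
pose t : algC := (w3 - w1 - w2)%:~R; pose q : algC := (w1 * w2)%:~R.
apply: (@root_monic_Aint ('X^2 - t *: 'X + q%:P)).
- rewrite /root !hornerE /=.
  have et : n%:R * t = x * y^* + y * x^*.
    rewrite /t !rmorphB /= !mulrBr -e1 -e2 -e3 rmorphD /=; ring.
  have eq : n%:R * n%:R * q = (x * y^*) * (y * x^*).
    rewrite /q rmorphM /= mulrACA -e1 -e2; ring.
  have nn : (n%:R * n%:R : algC) != 0 by rewrite mulf_neq0.
  apply/eqP/(mulfI nn); rewrite mulr0.
  transitivity ((x * y^*) ^+ 2 - n%:R * t * (x * y^*) + n%:R * n%:R * q).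
    by field.
  by rewrite et eq; ring.
- apply/monicP; rewrite -addrA lead_coefDl ?lead_coefXn //.
  rewrite size_polyXn (leq_ltn_trans (size_polyD _ _)) // gtn_max.
  rewrite size_polyN (leq_ltn_trans (size_scale_leq _ _)) ?size_polyX //=.
  by rewrite (leq_ltn_trans (size_polyC_leq1 _)).
- apply/polyOverP => i; rewrite coefD coefB coefXn coefZ coefX coefC.
  have -> : (if i == 0%N then q else 0) = (if i == 0%N then w1 * w2 else 0)%:~R.
    by case: ifP.
  by rewrite -[(i == 2%N)%:R]mulrz_nat -[(i == 1%N)%:R]mulrz_nat -!intrM -!intrB
    -intrD intr_int.
Qed.

Definition ideal_equiv (I J : nzideal) : bool :=
  `[< exists a b : algC, [/\ OK a, OK b, a != 0, b != 0
        & scale_set a I = scale_set b J] >].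

Lemma scale_setM a b I : scale_set (a * b) I = scale_set a (scale_set b I).
Proof.
rewrite eqEsubset; split=> [_ [x Ix <-]|_ [_ [x Ix <-] <-]].
  by rewrite -mulrA; exists (b * x) => //; exists x.
by rewrite mulrA; exists x.
Qed.

Lemma ideal_equiv_is_equiv : equiv_class_of ideal_equiv.
Proof.
split=> [I|I J|J I K].
- apply/asboolP; exists 1, 1; split; by rewrite ?oner_neq0 //; exact: OK1.
- by apply/asboolP/asboolP => -[a [b [? ? ? ? ?]]]; exists b, a; split.
- move=> /asboolP[a [b [Oa Ob a0 b0 e]]] /asboolP[a' [b' [Oa' Ob' a'0 b'0 e']]].
  apply/asboolP; exists (a' * a), (b * b').
  split; rewrite ?mulf_neq0 //; try exact: OKM.
  by rewrite scale_setM e -scale_setM mulrC !scale_setM e'.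
Qed.

Canonical ideal_equiv_rel := EquivRelPack ideal_equiv_is_equiv.
Canonical ideal_encModRel := defaultEncModRel ideal_equiv.

(* The ideal class group, written additively: 0 is the principal class, sums
   come from products of ideals, and the opposite of the class of I is the
   class of its conjugate, as I * conj I is generated by a rational integer. *)
Definition class_group := {eq_quot ideal_equiv}.
HB.instance Definition _ : EqQuotient _ ideal_equiv class_group :=
  EqQuotient.on class_group.
HB.instance Definition _ := Choice.on class_group.

Definition cl_zero : class_group := lift_cst class_group one_nzideal.
Definition cl_add := lift_op2 class_group mul_nzideal.
Definition cl_opp := lift_op1 class_group conj_nzideal.

Canonical pi_cl_zero_morph := PiConst cl_zero.

Lemma scale_conj_set a I :
  scale_set a^* (conj_set I) = conj_set (scale_set a I).
Proof.
rewrite eqEsubset; split=> [_ [_ [x Ix <-] <-]|_ [_ [x Ix <-] <-]].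
  by exists (a * x); [exists x|rewrite rmorphM].
by exists x^*; [exists x|rewrite rmorphM].
Qed.

Lemma scale_mul_set a b I J :
  scale_set (a * b) (mul_set I J) = mul_set (scale_set a I) (scale_set b J).
Proof.
rewrite eqEsubset; split.
  move=> _ [x + <-]; move: x; apply: mul_setP => [|x y|x y Ix Jy] /=.
  - by rewrite mulr0; exact: mul_set0.
  - by rewrite mulrDr; exact: mul_setD.
  - by rewrite mulrACA; apply: mul_setM; [exists x|exists y].
apply: mul_setP.
- by exists 0; [exact: mul_set0|rewrite mulr0].
- move=> _ _ [x Mx <-] [y My <-]; exists (x + y); last by rewrite mulrDr.
  exact: mul_setD.
- move=> _ _ [x Ix <-] [y Jy <-]; exists (x * y); last by rewrite mulrACA.
  exact: mul_setM.
Qed.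

Lemma pi_cl_opp : {morph \pi : I / conj_nzideal I >-> cl_opp I}.
Proof.
move=> I; unlock cl_opp; apply/eqP; rewrite piE.
have: I = repr (\pi_class_group I) %[mod class_group] by rewrite reprK.
move=> /eqP; rewrite piE => /asboolP[a [b [Oa Ob a0 b0 e]]].
apply/asboolP; exists a^*, b^*; split; rewrite ?fmorph_eq0 //;
  try exact: OKconj.
by rewrite /= !scale_conj_set e.
Qed.
Canonical pi_cl_opp_morph := PiMorph1 pi_cl_opp.

Lemma pi_cl_add : {morph \pi : I J / mul_nzideal I J >-> cl_add I J}.
Proof.
move=> I J; unlock cl_add; apply/eqP; rewrite piE.
have: I = repr (\pi_class_group I) %[mod class_group] by rewrite reprK.
move=> /eqP; rewrite piE => /asboolP[a [b [Oa Ob a0 b0 e]]].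
have: J = repr (\pi_class_group J) %[mod class_group] by rewrite reprK.
move=> /eqP; rewrite piE => /asboolP[a' [b' [Oa' Ob' a'0 b'0 e']]].
apply/asboolP; exists (a * a'), (b * b'); split; rewrite ?mulf_neq0 //;
  try exact: OKM.
by rewrite /= !scale_mul_set e e'.
Qed.
Canonical pi_cl_add_morph := PiMorph2 pi_cl_add.

Lemma cl_addA : associative cl_add.
Proof.
elim/quotW=> I; elim/quotW=> J; elim/quotW=> K.
by rewrite !piE mul_nzidealA.
Qed.

Lemma cl_addC : commutative cl_add.
Proof. by elim/quotW=> I; elim/quotW=> J; rewrite !piE mul_nzidealC. Qed.

Lemma cl_add0 : left_id cl_zero cl_add.
Proof. by elim/quotW=> I; rewrite !piE mul1_nzideal. Qed.

Lemma cl_addN : left_inverse cl_zero cl_opp cl_add.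
Proof.
elim/quotW=> I; rewrite !piE; apply/eqP; rewrite piE; apply/asboolP.
have [n n0 e] := mul_conj_nzideal I; exists 1, n%:R.
split; [exact: OK1|exact: OKnat|exact: oner_neq0|by rewrite pnatr_eq0 -lt0n|].
rewrite mul_nzidealC /= e -[principal _]/(scale_set n%:R OK) -scale_setM.
by rewrite mul1r.
Qed.

HB.instance Definition _ := GRing.isZmodule.Build class_group
  cl_addA cl_addC cl_add0 cl_addN.

Definition class_of_ideal (I : nzideal) : class_group := \pi_class_group I.

(* Cl(K)/E, where E = {x : x^2 = 1} is the 2-torsion subgroup. *)
Definition class_group_mod_E := Quotient.quot (two_torsion class_group).
HB.instance Definition _ := GRing.Zmodule.on class_group_mod_E.

Definition rho (x : class_group) : class_group_mod_E := \pi_class_group_mod_E x.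

Record prime_ideal := PrimeIdeal {
  prime_ideal_val :> nzideal;
  prime_ideal_proper : ~ nzideal_val prime_ideal_val 1;
  prime_ideal_prime : forall x y, OK x -> OK y ->
    nzideal_val prime_ideal_val (x * y) ->
    nzideal_val prime_ideal_val x \/ nzideal_val prime_ideal_val y }.

(* The rational prime p with P \cap Z = p Z. *)
Definition prime_below (P : prime_ideal) : nat :=
  xget 0%N [set p | prime p /\
    forall z : int, nzideal_val P z%:~R <-> (p%:Z %| z)%Z].

(* Primes p with (-m/p) = 1, i.e. those splitting in K. For p = 2 the
   convention is (-m/2) = 1 iff -m = 1 mod 8. *)
Definition split_primes : set nat :=
  [set p | prime p /\
    if p == 2 then (- m%:Z = 1 %[mod 8])%Z
    else ~~ (p %| m)%N /\ exists x : int, (x ^+ 2 = - m%:Z %[mod p])%Z].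

Definition delta : nat := if (- m%:Z == 1 %[mod 4])%Z then 0%N else 1%N.

Definition integer_elt (u v : int) : algC :=
  (u%:~R + v%:~R * sqrt_neg) / 2 ^+ (1 - delta)%N.

Definition split_primes0 (l : nat -> prime_ideal) : set nat :=
  [set p | split_primes p /\
           class_of_ideal (l p) \in two_torsion class_group].

Definition beta_on_L0 (p : nat) (x : pyth_group m) : Prop :=
  exists a b : nat, [/\ (0 < a)%N, (0 < b)%N
    & (a ^ 2 + m * b ^ 2 = p ^ 2)%N /\ is_class x a b p
      \/ (a ^ 2 + m * b ^ 2 = (2 * p) ^ 2)%N /\ is_class x a b (2 * p)%N].

Definition beta_on_generator (p : nat) (P : prime_ideal) (h : nat)
    (x : pyth_group m) : Prop :=
  exists u v : int,
    ((P : nzideal) ^+ (2 * h)%N)%g = principal (integer_elt u v) :> set algC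
    /\ is_class x `|u| `|v| (2 ^ (1 - delta) * p ^ h)%N.

(* The primitive triples t obtained from ideals J = J0 * Q_1^a_1 * ... * Q_n^a_n
   whose class is 2-torsion. As u and v may both be even when delta = 0, the
   triple (u, v, c) read off from J^2 need not be primitive: it is d t, with t
   its primitive representative. *)
Definition generic_triple (n : nat) (h : 'I_n -> nat) (P : 'I_n -> prime_ideal)
    (J0 : nzideal) (p : nat) (t : ptriple m) : Prop :=
  primitive t /\
  exists (Q : 'I_n -> nzideal) (a : 'I_n -> nat) (u v : int) (d : nat),
    let J := (J0 * \prod_(j < n) Q j ^+ a j)%g in
    let c := (2 ^ (1 - delta) * p * \prod_(j < n) prime_below (P j) ^ a j)%N in
    [/\ forall j, Q j = P j \/ Q j = conj_nzideal (P j),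
        forall j, (a j <= h j %/ 2)%N,
        class_of_ideal J \in two_torsion class_group,
        (J ^+ 2)%g = principal (integer_elt u v) :> set algC
      & (0 < d)%N /\ (u, v, c) = scale_triple d%:Z t].

Definition beta_generic (n : nat) (h : 'I_n -> nat) (P : 'I_n -> prime_ideal)
    (J0 : nzideal) (p : nat) (x : pyth_group m) : Prop :=
  exists t : ptriple m,
    [/\ generic_triple h P J0 p t,
        forall t', generic_triple h P J0 p t' -> `|t.1.1| <= `|t'.1.1|
      & is_class x `|t.1.1| `|t.1.2| t.2].

Definition beta_spec (l : nat -> prime_ideal) (n : nat) (h : 'I_n -> nat)
    (P : 'I_n -> prime_ideal) (p : nat) (x : pyth_group m) : Prop :=
  [\/ split_primes0 l p /\ beta_on_L0 p x,
      exists j, p = prime_below (P j) /\ beta_on_generator p (P j) (h j) x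
    | [/\ ~ split_primes0 l p, forall j, p <> prime_below (P j)
        & beta_generic h P (l p) p x]].

End QuadraticField.

(* Main.v *)
(** A class [a, b, c] is the number z = (a + b sqrt(-m)) / c of norm 1, taken up to
    sign. For a split prime p let e_p(z) be the valuation of z at l(p). At the
    conjugate prime the valuation is - e_p(z), and at a prime that is its own
    conjugate it is 0; as the only units are +1 and -1 for m > 3, the e_p embed
    P_m into the free abelian group on L. By Hilbert 90, z = w / conj w, so e_p(z)
    is the difference of the valuations of w at l(p) and at its conjugate; since
    (w) is principal this gives sum_p e_p(z) f(p) in E. If J^2 is generated by the
    numerator of z and the norm of J is its denominator, then (z) = J / conj J.
    Hence beta(p) has coordinates +1 or -1 at p and possibly nonzero ones at the
    p_j, except that beta(p_j) is + or - h_j times the j-th unit vector. Clearing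
    the coordinates of z outside the p_j leaves a relation between the generators
    of the G_j, which forces h_j to divide the j-th remaining coordinate. *)
Require Import Defs.
From HB Require Import structures.
From mathcomp Require Import all_boot all_order all_algebra all_field.
From mathcomp Require Import generic_quotient ring_quotient.
From mathcomp Require Import boolp classical_sets.
From mathcomp Require Import ring zify.

Set Implicit Arguments.
Unset Strict Implicit.
Unset Printing Implicit Defensive.

Import Order.TTheory GRing.Theory Num.Theory.
Local Open Scope ring_scope.
Local Open Scope classical_set_scope.

(** * Factorization of ideals *)

Section Ideals.
Variable m : nat.
Implicit Types (I J K : nzideal m) (P Q : prime_ideal m).
Local Notation OK := (ring_of_integers m).

Lemma mulIC I J : (I * J = J * I)%g.
Proof. exact: mul_nzidealC. Qed.

Lemma val_mulI I J : nzideal_val (I * J)%g = mul_set I J.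
Proof. by []. Qed.

Lemma val_oneI : nzideal_val (1%g : nzideal m) = OK.
Proof. by []. Qed.

Lemma conjI_mul I J : conj_nzideal (I * J)%g = (conj_nzideal I * conj_nzideal J)%g.
Proof.
apply: nzideal_inj; rewrite /= eqEsubset; split.
  move=> _ [x + <-]; move: x; apply: mul_setP => [|x y|x y Ix Jy] /=.
  - by rewrite rmorph0; exact: mul_set0.
  - by rewrite rmorphD; exact: mul_setD.
  - by rewrite rmorphM; apply: mul_setM; [exists x|exists y].
apply: mul_setP.
- by exists 0; [exact: mul_set0|rewrite rmorph0].
- move=> _ _ [x Mx <-] [y My <-]; exists (x + y); last by rewrite rmorphD.
  exact: mul_setD.
- move=> _ _ [x Ix <-] [y Jy <-]; exists (x * y); last by rewrite rmorphM.
  exact: mul_setM.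
Qed.

Lemma conjIK : involutive (@conj_nzideal m).
Proof.
move=> I; apply: nzideal_inj; rewrite /= eqEsubset; split.
  by move=> _ [_ [x Ix <-] <-]; rewrite conjCK.
by move=> x Ix; exists x^*; [exists x|rewrite conjCK].
Qed.

Lemma mem_conjI I x : nzideal_val (conj_nzideal I) x <-> nzideal_val I x^*.
Proof.
split=> [[y Iy <-]|Ix]; first by rewrite conjCK.
by exists x^*; rewrite ?conjCK.
Qed.

Lemma conjI1 : conj_nzideal (1%g : nzideal m) = 1%g.
Proof.
apply: nzideal_inj; rewrite eqEsubset; split=> x; rewrite mem_conjI => Ox.
  by rewrite -[x]conjCK; exact: OKconj.
exact: OKconj.
Qed.

Lemma conjIX I k : conj_nzideal (I ^+ k)%g = (conj_nzideal I ^+ k)%g.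
Proof.
elim: k => [|k IHk]; first by rewrite !expg0 conjI1.
by rewrite !expgS conjI_mul IHk.
Qed.

(** The default of [insubd] is the unit ideal, returned when [a] is zero or not integral; hence the
    conditions [OK a] and [a != 0] in what follows. *)
Definition pid (a : algC) : nzideal m := insubd (one_nzideal m) (principal m a).

Lemma pidE a : OK a -> a != 0 -> nzideal_val (pid a) = principal m a.
Proof.
move=> Oa a0; apply: insubdK; apply/asboolP; split; last first.
  by exists a => //; exists 1; [exact: OK1|rewrite mulr1].
split.
- by move=> _ [x Ox <-]; exact: OKM.
- by exists 0; [exact: OK0|rewrite mulr0].
- move=> _ _ [x Ox <-] [y Oy <-]; exists (x + y); last by rewrite mulrDr.
  exact: OKD.
- by move=> b _ Ob [x Ox <-]; exists (b * x); [exact: OKM|rewrite mulrCA].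
Qed.

Lemma mem_pid a x : OK a -> a != 0 ->
  nzideal_val (pid a) x <-> exists2 y, OK y & x = a * y.
Proof.
by move=> Oa a0; rewrite pidE //; split=> [[y Oy <-]|[y Oy ->]]; exists y.
Qed.

Lemma pid_mulE a I : OK a -> a != 0 ->
  nzideal_val (pid a * I)%g = scale_set a I.
Proof.
move=> Oa a0; rewrite val_mulI pidE //.
rewrite -[principal m a]/(scale_set a OK) -{1}[a]mulr1 -[X in mul_set _ X]/(nzideal_val I).
have -> : nzideal_val I = scale_set 1 I.
  by rewrite eqEsubset; split=> [x Ix|_ [x Ix <-]];
    rewrite ?mul1r //; exists x; rewrite ?mul1r.
rewrite -scale_mul_set !mulr1 -val_oneI -val_mulI mul1g.
by congr (scale_set a _); rewrite eqEsubset; split=> [x Ix|_ [x Ix <-]];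
    rewrite ?mul1r //; exists x; rewrite ?mul1r.
Qed.

Lemma pidM a b : OK a -> OK b -> a != 0 -> b != 0 ->
  pid (a * b) = (pid a * pid b)%g.
Proof.
move=> Oa Ob a0 b0; apply: nzideal_inj.
rewrite pid_mulE // !pidE ?mulf_neq0 //; last exact: OKM.
by rewrite -[principal m (_ * _)]/(scale_set _ OK) scale_setM.
Qed.

Lemma pid1 : pid 1 = 1%g.
Proof.
apply: nzideal_inj; rewrite pidE ?oner_neq0 //; last exact: OK1.
rewrite eqEsubset; split=> [_ [x Ox <-]|x Ox]; first by rewrite mul1r.
by exists x; rewrite ?mul1r.
Qed.

Lemma pid_conj a : OK a -> a != 0 -> pid a^* = conj_nzideal (pid a).
Proof.
move=> Oa a0; apply: nzideal_inj; rewrite /= !pidE ?fmorph_eq0 //; last exact: OKconj.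
rewrite -[principal m a^*]/(scale_set a^* OK) -[in LHS]val_oneI -conjI1.
exact: scale_conj_set.
Qed.

Lemma pid_mulI a I J : OK a -> a != 0 -> (pid a * I = pid a * J)%g -> I = J.
Proof.
move=> Oa a0 /(congr1 (@nzideal_val m)); rewrite !pid_mulE // => e.
suff sub I' J' : scale_set a I' = scale_set a J' ->
    nzideal_val I' `<=` nzideal_val J'.
  by apply: nzideal_inj; rewrite eqEsubset; split; apply: sub.
move=> {}e x Ix.
have : scale_set a I' (a * x) by exists x.
by rewrite e => -[y Jy /(mulfI a0) <-].
Qed.

Lemma ideal_norm_exists I :
  exists n : nat, (0 < n)%N /\ (I * conj_nzideal I)%g = pid n%:R.
Proof.
have [n n0 e] := mul_conj_nzideal I; exists n; split=> //.
apply: nzideal_inj; rewrite pidE ?pnatr_eq0 -?lt0n //; exact: OKnat.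
Qed.

(** The absolute norm, taken as the positive generator of [I * conj I] instead of an index, so that
    multiplicativity is immediate. *)
Definition ideal_norm I : nat :=
  xget 0%N [set n | (0 < n)%N /\ (I * conj_nzideal I)%g = pid n%:R].

Lemma ideal_normP I :
  (0 < ideal_norm I)%N /\ (I * conj_nzideal I)%g = pid (ideal_norm I)%:R.
Proof. exact: (xgetPex 0%N (ideal_norm_exists I)). Qed.

Lemma ideal_norm_gt0 I : (0 < ideal_norm I)%N.
Proof. by case: (ideal_normP I). Qed.

Lemma mul_conjI I : (I * conj_nzideal I)%g = pid (ideal_norm I)%:R.
Proof. by case: (ideal_normP I). Qed.

Lemma natC_neq0 n : (0 < n)%N -> (n%:R : algC) != 0.
Proof. by rewrite pnatr_eq0 -lt0n. Qed.

(** Multiplying by the conjugate of [I] replaces [I] by the principal ideal of its norm, and scaling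
    by a nonzero number is injective. *)
Lemma mulI_inj I J K : (I * J = I * K)%g -> J = K.
Proof.
move=> e; have n0 := natC_neq0 (ideal_norm_gt0 I).
apply: (pid_mulI (OKnat m (ideal_norm I)) n0).
by rewrite -mul_conjI (mulIC I) -!mulgA e.
Qed.

(** A quotient of rational integers is rational, so it is an algebraic integer only if it is an
    integer. *)
Lemma mem_pid_int (n : nat) (z : int) : (0 < n)%N ->
  nzideal_val (pid n%:R) z%:~R <-> (n%:Z %| z)%Z.
Proof.
move=> n0; have n0C := natC_neq0 n0; rewrite mem_pid //; last exact: OKnat.
split=> [[y Oy e]|/dvdzP[q ->]]; last first.
  by exists q%:~R; [exact: OKint|rewrite mulrC intrM].
have ey : y = ratr (z%:~R / n%:R).
  by rewrite rmorphM fmorphV /= ratr_int ratr_nat e mulrAC divff ?mul1r.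
have : y \in Num.int.
  by apply: Cint_rat_Aint; [rewrite ey Crat_rat|case: Oy].
move=> /intrP[q eq]; apply/dvdzP; exists q; apply/eqP.
by rewrite -(eqr_int algC) e eq mulrC intrM.
Qed.

Lemma pid_nat_inj (n k : nat) : (0 < n)%N -> (0 < k)%N ->
  pid n%:R = pid k%:R -> n = k.
Proof.
move=> n0 k0 e; apply/eqP; rewrite eqn_dvd; apply/andP; split.
  by have /(_ _) := (mem_pid_int k%:Z n0).1; rewrite e; apply; apply/mem_pid_int.
by have /(_ _) := (mem_pid_int n%:Z k0).1; rewrite -e; apply; apply/mem_pid_int.
Qed.

Lemma ideal_normM I J : ideal_norm (I * J)%g = (ideal_norm I * ideal_norm J)%N.
Proof.
apply: pid_nat_inj; rewrite ?muln_gt0 ?ideal_norm_gt0 //.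
rewrite natrM pidM ?natC_neq0 ?ideal_norm_gt0 //; try exact: OKnat.
rewrite -!mul_conjI conjI_mul -!mulgA; congr (_ * _)%g.
by rewrite !mulgA (mulIC J).
Qed.

Lemma subI_mul I J : nzideal_val (I * J)%g `<=` I.
Proof.
have hI := nzideal_ideal I; apply: mul_setP; [exact: (ideal0 hI)|exact: (idealD hI)|].
move=> x y Ix Jy; rewrite mulrC; apply: (idealM hI) => //.
exact: ideal_sub (nzideal_ideal J) _ Jy.
Qed.

Lemma ideal_norm_eq1 I : ideal_norm I = 1%N -> I = 1%g.
Proof.
move=> e; apply: nzideal_inj; rewrite eqEsubset; split.
  exact: ideal_sub (nzideal_ideal I).
by rewrite -pid1 -[1]/(1%:R) -e -mul_conjI; exact: subI_mul.
Qed.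

(** To contain is to divide: [I * conj J] lies in [J * conj J], which is generated by the norm n of
    [J], so dividing it by n gives an integral ideal [K]. *)
Lemma subI_dvd I J : nzideal_val I `<=` J -> exists K, I = (J * K)%g.
Proof.
move=> IJ; set n := ideal_norm J; have n0 := natC_neq0 (ideal_norm_gt0 J).
have On := OKnat m n.
have hM := nzideal_ideal (I * conj_nzideal J)%g.
pose K0 : set algC := [set x | OK x /\ nzideal_val (I * conj_nzideal J)%g (n%:R * x)].
have sub : nzideal_val (I * conj_nzideal J)%g `<=` pid n%:R.
  rewrite -mul_conjI; apply: mul_setP; [exact: mul_set0|exact: mul_setD|].
  by move=> x y Ix Jy; apply: mul_setM => //; apply: IJ.
have K0P : `[< is_nzideal m K0 >].
  apply/asboolP; split; first split.
  - by move=> x [].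
  - by split; [exact: OK0|rewrite mulr0; exact: (ideal0 hM)].
  - by move=> x y [Ox Mx] [Oy My]; split;
      [exact: OKD|rewrite mulrDr; exact: (idealD hM)].
  - by move=> a x Oa [Ox Mx]; split; [exact: OKM|rewrite mulrCA; exact: (idealM hM)].
  - have [x Mx x0] : exists2 x, nzideal_val (I * conj_nzideal J)%g x & x != 0.
      by case: ((I * conj_nzideal J)%g) => M /= /asboolP[].
    have /(mem_pid x On n0)[y Oy ey] := sub _ Mx.
    exists y; first by split; rewrite -?ey.
    by apply: contra_neq x0 => y0; rewrite ey y0 mulr0.
pose K := NzIdeal K0P; exists K; apply: (pid_mulI On n0).
have -> : (pid n%:R * (J * K) = J * (pid n%:R * K))%g by rewrite !mulgA (mulIC J).
have -> : (pid n%:R * K = I * conj_nzideal J)%g.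
  apply: nzideal_inj; rewrite pid_mulE // eqEsubset; split.
    by move=> _ [x [Ox Mx] <-].
  move=> x Mx; have /(mem_pid x On n0)[y Oy ey] := sub _ Mx.
  by exists y => //; split; rewrite -?ey.
by rewrite -mul_conjI (mulIC I) mulgA.
Qed.

Lemma prime_neq1 P : (P : nzideal m) <> 1%g.
Proof. by move=> e; case: (prime_ideal_proper (p := P)); rewrite e; exact: OK1. Qed.

Lemma prime_norm_gt1 P : (1 < ideal_norm P)%N.
Proof.
have := ideal_norm_gt0 P; case e : (ideal_norm P) => [|[|k]] // _.
by case: (@prime_neq1 P); exact: ideal_norm_eq1.
Qed.

Lemma prime_subM P I J :
  nzideal_val (I * J)%g `<=` P -> nzideal_val I `<=` P \/ nzideal_val J `<=` P.
Proof.
move=> IJP; case: (pselect (nzideal_val I `<=` P)) => [|nIP]; [by left|right].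
have /existsNP[x /not_implyP[Ix nPx]] : ~ forall x, nzideal_val I x -> nzideal_val P x by [].
move=> y Jy; have : nzideal_val P (x * y) by apply: IJP; apply: mul_setM.
case/prime_ideal_prime => //; [exact: ideal_sub (nzideal_ideal I) _ Ix|].
exact: ideal_sub (nzideal_ideal J) _ Jy.
Qed.

Lemma conj_prime_proper P : ~ nzideal_val (conj_nzideal P) 1.
Proof. by rewrite mem_conjI rmorph1; exact: prime_ideal_proper. Qed.

Lemma conj_prime_prime P x y : OK x -> OK y ->
  nzideal_val (conj_nzideal P) (x * y) ->
  nzideal_val (conj_nzideal P) x \/ nzideal_val (conj_nzideal P) y.
Proof.
move=> Ox Oy; rewrite !mem_conjI rmorphM.
by apply: prime_ideal_prime; exact: OKconj.
Qed.

Definition conj_prime P : prime_ideal m :=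
  PrimeIdeal (@conj_prime_proper P) (@conj_prime_prime P).

(** Among the proper ideals containing [I], one of least norm is maximal, and maximal ideals are
    prime. *)
Lemma exists_prime_above I : I <> 1%g -> exists P, nzideal_val I `<=` P.
Proof.
move=> I1.
pose S k := `[< exists J, [/\ ideal_norm J = k, J <> 1%g & nzideal_val I `<=` J] >].
have exS : exists k, S k.
  by exists (ideal_norm I); apply/asboolP; exists I; split.
case: (ex_minnP exS) => k /asboolP[J [Jk J1 IJ]] kmin.
have hJ := nzideal_ideal J.
(* By [subI_dvd] the norm of [K] divides that of [J]; minimality leaves a cofactor of norm 1. *)
have Jmax K : nzideal_val J `<=` K -> K <> 1%g -> K = J.
  move=> JK K1; have [M eM] := subI_dvd JK.
  have kK : (k <= ideal_norm K)%N.
    by apply: kmin; apply/asboolP; exists K; split=> // x /IJ/JK.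
  have eN := Jk; rewrite eM ideal_normM in eN.
  have K0 := ideal_norm_gt0 K; have M0 := ideal_norm_gt0 M.
  have M1 : ideal_norm M = 1%N by nia.
  by rewrite eM (ideal_norm_eq1 M1) mulg1.
have proper : ~ nzideal_val J 1.
  move=> Jone; apply: J1; apply: nzideal_inj; rewrite eqEsubset; split.
    exact: (ideal_sub hJ).
  by move=> x Ox; rewrite -[x]mulr1; exact: (idealM hJ).
have pr x y : OK x -> OK y -> nzideal_val J (x * y) ->
    nzideal_val J x \/ nzideal_val J y.
  move=> Ox Oy Jxy; case: (pselect (nzideal_val J x)) => [|nJx]; [by left|right].
  (* This is J + (x). As x is not in [J], it is the whole ring, and multiplying [1 = j + r * x] by
     [y] puts [y] in [J]. *)
  pose K0 : set algC := [set z | exists j r, [/\ nzideal_val J j, OK r & z = j + r * x]].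
  have JK0 : nzideal_val J `<=` K0.
    by move=> j Jj; exists j, 0; split=> //; [exact: OK0|rewrite mul0r addr0].
  have K0P : `[< is_nzideal m K0 >].
    apply/asboolP; split; first split.
    - move=> _ [j [r [Jj Or ->]]]; apply: OKD; last exact: OKM.
      exact: ideal_sub hJ _ Jj.
    - by apply: JK0; exact: (ideal0 hJ).
    - move=> _ _ [j [r [Jj Or ->]]] [j' [r' [Jj' Or' ->]]].
      exists (j + j'), (r + r'); split; [exact: (idealD hJ)|exact: OKD|ring].
    - move=> a _ Oa [j [r [Jj Or ->]]].
      by exists (a * j), (a * r); split; [exact: (idealM hJ)|exact: OKM|ring].
    - have [z Jz z0] : exists2 z, nzideal_val J z & z != 0.
        by case: (J) => M /= /asboolP[].
      by exists z => //; apply: JK0.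
  pose K := NzIdeal K0P.
  case: (pselect (K = 1%g)) => [eK|K1]; last first.
    case: nJx; rewrite -(Jmax K JK0 K1).
    by exists 0, 1; split; [exact: (ideal0 hJ)|exact: OK1|rewrite mul1r add0r].
  have : nzideal_val K 1 by rewrite eK; exact: OK1.
  move=> [j [r [Jj Or e]]]; rewrite -[y]mul1r e mulrDl; apply: (idealD hJ) => //.
    by rewrite mulrC; exact: (idealM hJ).
  by rewrite -mulrA; exact: (idealM hJ).
by exists (PrimeIdeal proper pr).
Qed.

(** Existence of prime factorizations, as an induction principle: splitting off a prime lowers the
    norm. *)
Lemma nzideal_prime_ind (S : nzideal m -> Prop) : S 1%g ->
  (forall P I, S I -> S ((P : nzideal m) * I)%g) -> forall I, S I.
Proof.
move=> S1 SM I; have [k] := ubnP (ideal_norm I).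
elim: k I => // k IHk I ltI.
case: (pselect (I = 1%g)) => [->//|/exists_prime_above[P /subI_dvd[J eJ]]].
rewrite eJ; apply: SM; apply: IHk; move: ltI.
rewrite eJ ideal_normM.
have := prime_norm_gt1 P; have := ideal_norm_gt0 J; nia.
Qed.

(** * Valuations at prime ideals and unique factorization *)

Lemma ideal_val_exists P I :
  exists k J, I = ((P : nzideal m) ^+ k * J)%g /\ ~ (nzideal_val J `<=` P).
Proof.
have [k] := ubnP (ideal_norm I).
elim: k I => // k IHk I ltI.
case: (pselect (nzideal_val I `<=` P)) => [/subI_dvd[J eJ]|nIP]; last first.
  by exists 0%N, I; rewrite expg0 mul1g.
have [|i [K [eK nK]]] := IHk J.
  move: ltI; rewrite eJ ideal_normM.
  have := prime_norm_gt1 P; have := ideal_norm_gt0 J; nia.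
by exists i.+1, K; split=> //; rewrite expgS -mulgA -eK.
Qed.

(** [P] is a bare ideal, so that equalities between the ideals underlying two prime records can be
    rewritten in it. *)
Definition ideal_val (P I : nzideal m) : nat :=
  xget 0%N [set k | exists J, I = (P ^+ k * J)%g /\ ~ (nzideal_val J `<=` P)].

Lemma ideal_valP P I :
  exists J, I = ((P : nzideal m) ^+ ideal_val P I * J)%g /\ ~ (nzideal_val J `<=` P).
Proof. exact: (xgetPex 0%N (ideal_val_exists P I)). Qed.

(** Uniqueness of the exponent: if a < b, cancelling [P ^+ a] exhibits the cofactor [I1] as a
    multiple of [P], so [I1] would lie in [P]. *)
Lemma ideal_val_eq P I J k :
  I = ((P : nzideal m) ^+ k * J)%g -> ~ (nzideal_val J `<=` P) -> ideal_val P I = k.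
Proof.
suff lt_false I1 I2 (a b : nat) :
    ((P : nzideal m) ^+ a * I1 = (P : nzideal m) ^+ b * I2)%g ->
    ~ (nzideal_val I1 `<=` P) -> (a < b)%N -> False.
  move=> e nJ; have [K [eK nK]] := ideal_valP P I.
  case: (ltngtP (ideal_val P I) k) => // lt.
    by case: (lt_false K J _ _ _ nK lt); rewrite -eK e.
  by case: (lt_false J K _ _ _ nJ lt); rewrite -eK e.
move=> e nI1 /subnKC; rewrite addSn => eb; apply: nI1.
move: e; rewrite -eb -addnS expgnDr -mulgA => /mulI_inj ->.
by rewrite expgS -mulgA; exact: subI_mul.
Qed.

Lemma ideal_valM P I J : ideal_val P (I * J)%g = (ideal_val P I + ideal_val P J)%N.
Proof.
have [I1 [eI nI]] := ideal_valP P I; have [J1 [eJ nJ]] := ideal_valP P J.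
apply: (@ideal_val_eq _ _ (I1 * J1)%g); last by case/prime_subM.
rewrite {1}eI {1}eJ expgnDr -!mulgA; congr (_ * _)%g.
by rewrite !mulgA (mulIC I1).
Qed.

Lemma ideal_val_eq0 P I : (ideal_val P I = 0)%N <-> ~ (nzideal_val I `<=` P).
Proof.
split=> [e|nI]; last by apply: (@ideal_val_eq _ _ I) => //; rewrite expg0 mul1g.
by have [J []] := ideal_valP P I; rewrite e expg0 mul1g => <-.
Qed.

Lemma ideal_val1 P : ideal_val P 1%g = 0%N.
Proof. by apply/ideal_val_eq0 => /(_ 1 (OK1 m)); exact: prime_ideal_proper. Qed.

Lemma ideal_valX P I k : ideal_val P (I ^+ k)%g = (k * ideal_val P I)%N.
Proof.
elim: k => [|k IHk]; first by rewrite expg0 ideal_val1.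
by rewrite expgS ideal_valM IHk mulSn.
Qed.

Lemma ideal_val_self P : ideal_val P P = 1%N.
Proof.
apply: (@ideal_val_eq _ _ 1%g); first by rewrite expg1 mulg1.
by move=> /(_ 1 (OK1 m)); exact: prime_ideal_proper.
Qed.

Lemma ideal_val_conj P I :
  ideal_val (conj_nzideal P) (conj_nzideal I) = ideal_val P I.
Proof.
have [J [e nJ]] := ideal_valP P I.
apply: (@ideal_val_eq (conj_prime P) _ (conj_nzideal J)).
  by rewrite {1}e conjI_mul conjIX.
move=> sub; apply: nJ => x Jx.
have : nzideal_val (conj_nzideal J) x^* by apply/mem_conjI; rewrite conjCK.
by move/sub/mem_conjI; rewrite conjCK.
Qed.

(** A prime split off from [I] has positive valuation on [J] too, so it divides [J] and cancels. An
    ideal with all valuations zero lies in no prime, hence is the unit ideal. *)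
Lemma ideal_val_inj I J : (forall P, ideal_val P I = ideal_val P J) -> I = J.
Proof.
elim/nzideal_prime_ind: I J => [J e|P I IHI J e].
  apply: contrapT => J1; have [P JP] := exists_prime_above (I := J) (fun h => J1 (esym h)).
  by have := e P; rewrite ideal_val1 => /esym/ideal_val_eq0; apply.
have /subI_dvd[K eK] : nzideal_val J `<=` P.
  apply: contrapT => /ideal_val_eq0; rewrite -e ideal_valM ideal_val_self; lia.
rewrite eK; congr (_ * _)%g; apply: IHI => Q.
by have := e Q; rewrite eK !ideal_valM => /addnI.
Qed.

End Ideals.

(** * Primes above a rational prime *)

Section PrimesAndClasses.
Variable m : nat.
Implicit Types (I J K : nzideal m) (P Q : prime_ideal m).
Local Notation OK := (ring_of_integers m).

Lemma OK_quadratic x (t n : int) : quadratic_field m x ->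
  x ^+ 2 - t%:~R * x + n%:~R = 0 -> OK x.
Proof.
move=> Kx e; split=> //.
apply: (@root_monic_Aint ('X^2 - t%:~R *: 'X + (n%:~R)%:P)).
- by rewrite /root !hornerE /= e.
- apply/monicP; rewrite -addrA lead_coefDl ?lead_coefXn //.
  rewrite size_polyXn (leq_ltn_trans (size_polyD _ _)) // gtn_max.
  rewrite size_polyN (leq_ltn_trans (size_scale_leq _ _)) ?size_polyX //=.
  by rewrite (leq_ltn_trans (size_polyC_leq1 _)).
- apply/polyOverP => i; rewrite coefD coefB coefXn coefZ coefX coefC.
  have -> : (if i == 0%N then n%:~R else 0) = (if i == 0%N then n else 0)%:~R :> algC.
    by case: ifP.
  by rewrite -[(i == 2%N)%:R]mulrz_nat -[(i == 1%N)%:R]mulrz_nat -!intrM -!intrB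
    -intrD intr_int.
Qed.

Lemma OK_sqrt_neg : OK (sqrt_neg m).
Proof.
apply: (@OK_quadratic _ 0 m%:Z).
  by exists 0, 1; rewrite rmorph0 rmorph1 add0r mul1r.
by rewrite mul0r subr0 expr2 sqrt_neg_sqr addNr.
Qed.

Lemma OKtrace_int x : OK x -> x + x^* \in Num.int.
Proof.
move=> Ox; apply: Cint_rat_Aint; last by case: (OKD Ox (OKconj Ox)).
case: Ox => -[a [b ->]] _; rewrite conj_elt.
suff -> : (ratr a + ratr b * sqrt_neg m) + (ratr a - ratr b * sqrt_neg m)
  = ratr (a + a) by exact: Crat_rat.
by rewrite rmorphD /=; ring.
Qed.

Lemma OKN x : OK x -> OK (- x).
Proof. by move=> Ox; rewrite -mulN1r; apply: OKM => //; exact: (OKint m (-1)). Qed.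

Lemma idealB I x y : nzideal_val I x -> nzideal_val I y -> nzideal_val I (x - y).
Proof.
move=> Ix Iy; apply: (idealD (nzideal_ideal I)) => //.
by rewrite -mulN1r; apply: (idealM (nzideal_ideal I)) => //; exact: (OKint m (-1)).
Qed.

(** The least positive integer in [P] generates all integers in [P] by division with remainder; it
    is prime because [P] is. *)
Lemma prime_belowP P : prime (prime_below P) /\
  forall z : int, nzideal_val P z%:~R <-> ((prime_below P)%:Z %| z)%Z.
Proof.
suff: exists p : nat, [set p | prime p /\
    forall z : int, nzideal_val P z%:~R <-> (p%:Z %| z)%Z] p.
  exact: xgetPex.
have hP := nzideal_ideal P.
pose S k := (0 < k)%N && `[< nzideal_val P k%:R >].
have exS : exists k, S k.
  exists (ideal_norm P); rewrite /S ideal_norm_gt0; apply/asboolP.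
  apply: (@subI_mul _ P (conj_nzideal P)); rewrite mul_conjI.
  by apply: (mem_pid_int m (ideal_norm P) (ideal_norm_gt0 P)).2; exact: dvdzz.
case: (ex_minnP exS) => k /andP[k0 /asboolP Pk] kmin.
have kP (z : int) : nzideal_val P z%:~R <-> (k%:Z %| z)%Z.
  split=> [Pz|/dvdzP[q ->]]; last first.
    by rewrite intrM; apply: (idealM hP) => //; exact: OKint.
  have: nzideal_val P (z %% k)%Z%:~R.
    rewrite /modz intrB intrM; apply: idealB => //.
    by apply: (idealM hP) => //; exact: OKint.
  have r0 : (0 <= z %% k)%Z by rewrite modz_ge0; lia.
  have rn : (z %% k < k)%Z by rewrite ltz_mod; lia.
  move=> Pr; apply/dvdz_mod0P; case: (z %% k)%Z r0 rn Pr => // r _ rk Pr.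
  case: r rk Pr => // r rk Pr; have := kmin r.+1; rewrite /S /=.
  by move=> /(_ (introT (asboolP _) Pr)); lia.
exists k; split=> //.
have k1 : (1 < k)%N.
  case: k k0 Pk {kmin kP} => [|[|k]] // _ P1.
  by case: (@prime_ideal_proper _ P).
have := pdiv_dvd k; case/dvdnP => q eq.
have pp := pdiv_prime k1; have p1 := prime_gt1 pp.
have : nzideal_val P (q%:R * (pdiv k)%:R) by rewrite -natrM -eq.
case/prime_ideal_prime; [exact: OKnat|exact: OKnat| |].
- move=> Pq; have q0 : (0 < q)%N by case: (q) eq k0 => // ->.
  have := kmin q; rewrite /S q0 (introT (asboolP _) Pq) => /(_ isT).
  by move: eq q0 p1; set d := pdiv k; nia.
- move=> Pp; have := kmin (pdiv k); rewrite /S (introT (asboolP _) Pp) andbT.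
  move=> /(_ (ltnW p1)) kle; have := pdiv_leq k0 => lek.
  by have -> : k = pdiv k by apply/eqP; rewrite eqn_leq kle lek.
Qed.

Lemma prime_below_prime P : prime (prime_below P).
Proof. by case: (prime_belowP P). Qed.

Lemma mem_int_prime P (z : int) :
  nzideal_val P z%:~R <-> ((prime_below P)%:Z %| z)%Z.
Proof. by case: (prime_belowP P). Qed.

Lemma prime_below_conj P : prime_below (conj_prime P) = prime_below P.
Proof.
have : nzideal_val (conj_prime P) (prime_below P)%:~R.
  by apply/mem_conjI; rewrite rmorph_int; apply/mem_int_prime.
move/mem_int_prime; rewrite dvdzE /= dvdn_prime2 ?prime_below_prime //.
by move/eqP.
Qed.

(** Nonzero primes are maximal. For x in [Q] the norm is an integer in [Q], hence in [P], so [P]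
    contains x or its conjugate; in the second case the trace, also an integer in [Q], brings x into
    [P]. *)
Lemma prime_sub_eq P Q : nzideal_val P `<=` Q -> (P : nzideal m) = Q.
Proof.
move=> PQ; have e : prime_below Q = prime_below P.
  have /PQ/mem_int_prime : nzideal_val P (prime_below P)%:~R by apply/mem_int_prime.
  by rewrite dvdzE /= dvdn_prime2 ?prime_below_prime // => /eqP.
have QP (z : int) : nzideal_val Q z%:~R -> nzideal_val P z%:~R.
  by move=> /mem_int_prime Qz; apply/mem_int_prime; rewrite -e.
apply: nzideal_inj; rewrite eqEsubset; split=> // x Qx.
have Ox := ideal_sub (nzideal_ideal Q) Qx; have Ox' := OKconj Ox.
have /intrP[z ez] := OKnorm_int Ox; have /intrP[w ew] := OKtrace_int Ox.
have : nzideal_val P (x * x^*).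
  rewrite ez; apply: QP; rewrite -ez mulrC.
  exact: (idealM (nzideal_ideal Q)).
case/prime_ideal_prime => // Px'.
have -> : x = w%:~R - x^* by rewrite -ew addrK.
apply: idealB => //; apply: QP; rewrite -ew.
by apply: (idealD (nzideal_ideal Q)) => //; exact: PQ.
Qed.

(** Prime avoidance: the norm of z in [P] is an integer of [Q], so z lies in [Q] or in its
    conjugate; a group covered by two subgroups lies in one of them. *)
Lemma same_prime_below P Q : prime_below P = prime_below Q ->
  (P : nzideal m) = Q \/ (P : nzideal m) = conj_nzideal Q.
Proof.
move=> e; case: (pselect (nzideal_val P `<=` Q)) => [/prime_sub_eq|]; first by left.
move=> /existsNP[x /not_implyP[Px nQx]].
case: (pselect (nzideal_val P `<=` conj_prime Q)) => [/prime_sub_eq|]; first by right.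
move=> /existsNP[y /not_implyP[Py nQy]].
have cover z : nzideal_val P z -> nzideal_val Q z \/ nzideal_val (conj_prime Q) z.
  move=> Pz; have Oz := ideal_sub (nzideal_ideal P) Pz; have Oz' := OKconj Oz.
  have : nzideal_val P (z * z^*) by rewrite mulrC; exact: (idealM (nzideal_ideal P)).
  have /intrP[w ew] := OKnorm_int Oz; rewrite ew => /mem_int_prime; rewrite e.
  move/mem_int_prime; rewrite -ew => /prime_ideal_prime[] // Qz; [by left|right].
  exact/mem_conjI.
have Q'x : nzideal_val (conj_prime Q) x by case: (cover x Px).
have Qy : nzideal_val Q y by case: (cover y Py).
exfalso; case: (cover (x + y)); first exact: (idealD (nzideal_ideal P)).
  by move=> Qxy; apply: nQx; rewrite -(addrK y x); exact: idealB.
by move=> Qxy; apply: nQy; rewrite -(addKr x y) addrC; exact: idealB.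
Qed.

Lemma ideal_val_prime P Q : ideal_val P Q = ((P : nzideal m) == Q) :> nat.
Proof.
case: eqVneq => [<-|/eqP ne]; first exact: ideal_val_self.
by apply/ideal_val_eq0 => /prime_sub_eq e; apply: ne.
Qed.

(** A self-conjugate prime containing a product of two conjugates contains both of them, hence their
    sum. For odd p take x + sqrt(-m) and x - sqrt(-m): the sum 2x forces p to divide m. For p = 2
    take w = (1 + sqrt(-m)) / 2 and 1 - w: the sum is 1. *)
Lemma split_conj_neq P :
  split_primes m (prime_below P) -> conj_nzideal P <> P :> nzideal m.
Proof.
move=> [pp +] e.
have Pconj x : nzideal_val P x -> nzideal_val P x^*.
  by move=> Px; apply/mem_conjI; rewrite e.
have es := sqrt_neg_sqr m; have cs := conj_sqrt_neg m.
case: ifP => [/eqP p2 m8|p2 [ndvd [x ex]]].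
- have [k ek] : exists k : int, 1 + m%:Z = 4 * (2 * k).
    exists ((1 + m%:Z) %/ 8)%Z; lia.
  pose w : algC := (1 + sqrt_neg m) / 2.
  have two0 : (2 : algC) != 0 by rewrite pnatr_eq0.
  have ekC : 1 + m%:R = 4 * (2 * k%:~R) :> algC.
    have := congr1 (fun z : int => z%:~R : algC) ek.
    by rewrite !intrM !intrD.
  have ew : w * (1 - w) = 2 * k%:~R.
    have -> : w * (1 - w) = (1 - sqrt_neg m * sqrt_neg m) / 4 by rewrite /w; field.
    by rewrite es opprK ekC; field.
  have Kw : quadratic_field m w.
    exists (1 / 2), (1 / 2); rewrite !rmorphM fmorphV /= rmorph1 ratr_nat /w.
    by field.
  have Ow : OK w.
    apply: (@OK_quadratic _ 1 (2 * k)) => //.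
    by rewrite intrM -ew; ring.
  have cw : w^* = 1 - w.
    rewrite /w rmorphM /= fmorphV /= rmorphD /= rmorph1 conjC_nat cs.
    by field.
  have Ow' : OK (1 - w) by rewrite -cw; exact: OKconj.
  have Pw : nzideal_val P w \/ nzideal_val P (1 - w).
    apply: prime_ideal_prime => //; rewrite ew -[2]/(2%:~R) -intrM.
    by apply/mem_int_prime; rewrite p2 dvdz_mulr.
  apply: (@prime_ideal_proper _ P).
  have -> : 1 = w + (1 - w) by ring.
  apply: (idealD (nzideal_ideal P)).
    case: Pw => // /Pconj; rewrite -cw conjCK //.
  by case: Pw => // /Pconj; rewrite cw.
- set p := prime_below P in pp p2 ndvd ex *.
  have pdvd : (p%:Z %| x ^+ 2 + m%:Z)%Z.
    have : (p%:Z %| x ^+ 2 - (- m%:Z))%Z by rewrite -eqz_mod_dvd; apply/eqP.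
    by rewrite opprK.
  have Ox : OK x%:~R by exact: OKint.
  have Os := OK_sqrt_neg.
  have Oxs : OK (x%:~R + sqrt_neg m) by exact: OKD.
  have Oxs' : OK (x%:~R - sqrt_neg m) by apply: OKD => //; exact: OKN.
  have cxs : (x%:~R + sqrt_neg m)^* = x%:~R - sqrt_neg m.
    by rewrite rmorphD rmorph_int /= cs.
  have exs : (x%:~R + sqrt_neg m) * (x%:~R - sqrt_neg m) = (x ^+ 2 + m%:Z)%:~R.
    rewrite intrD rmorphXn /=.
    transitivity (x%:~R ^+ 2 - sqrt_neg m * sqrt_neg m); first by ring.
    by rewrite es opprK.
  have Pxs : nzideal_val P (x%:~R + sqrt_neg m) \/ nzideal_val P (x%:~R - sqrt_neg m).
    by apply: prime_ideal_prime => //; rewrite exs; apply/mem_int_prime.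
  have : nzideal_val P (x *+ 2)%:~R.
    have -> : (x *+ 2)%:~R = (x%:~R + sqrt_neg m) + (x%:~R - sqrt_neg m).
      by rewrite mulr2n intrD; ring.
    apply: (idealD (nzideal_ideal P)).
      by case: Pxs => // /Pconj; rewrite -cxs conjCK.
    by case: Pxs => // /Pconj; rewrite cxs.
  move=> /mem_int_prime; rewrite -/p -mulr_natr dvdzE abszM /= Euclid_dvdM //.
  have -> : (p %| 2)%N = false.
    by rewrite dvdn_prime2 //; exact: p2.
  rewrite orbF => px; move/negP: ndvd; apply.
  have : (p%:Z %| m%:Z)%Z.
    rewrite -[m%:Z](addKr (x ^+ 2)) rpredD // rpredN dvdz_exp //.
  by [].
Qed.

(** After division by the gcd, the cofactors of x and y are coprime, so the square of the first
    divides m and square-freeness makes it 1. *)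
Lemma square_free_sqr_dvd (x y : int) (k : int) : square_free m -> x != 0 ->
  m%:Z * y ^+ 2 = k * x ^+ 2 -> (x %| y)%Z.
Proof.
move=> sqf x0 e; rewrite dvdzE.
have {}e : (`|x| ^ 2 %| m * `|y| ^ 2)%N.
  apply/dvdnP; exists `|k|%N.
  by have := congr1 absz e; rewrite abszM abszX [RHS]abszM abszX.
set X := `|x|%N in e *; set Y := `|y|%N in e *.
have X0 : (0 < X)%N by rewrite absz_gt0.
have g0 : (0 < gcdn X Y)%N by rewrite gcdn_gt0 X0.
have eX : X = (X %/ gcdn X Y * gcdn X Y)%N by rewrite divnK ?dvdn_gcdl.
have eY : Y = (Y %/ gcdn X Y * gcdn X Y)%N by rewrite divnK ?dvdn_gcdr.
have cop : coprime (X %/ gcdn X Y) (Y %/ gcdn X Y).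
  by rewrite /coprime -(eqn_pmul2r g0) muln_gcdl -eX -eY mul1n.
move: (gcdn X Y) (X %/ gcdn X Y)%N (Y %/ gcdn X Y)%N g0 eX eY cop.
move=> g X1 Y1 g0 eX eY cop; move: e; rewrite eX eY !expnMn mulnA.
rewrite dvdn_pmul2r ?expn_gt0 ?g0 // Gauss_dvdl ?coprimeXl ?coprimeXr //.
by move/sqf => ->; rewrite mul1n dvdn_mull.
Qed.

(** Take x in [P] with conjugate outside [P]: p divides its norm n but not its trace t. The
    discriminant t^2 - 4n is -m y^2 for an integer y, which makes -m a square modulo p, or 1 modulo
    8 when p = 2. *)
Lemma conj_neq_split P : square_free m ->
  conj_nzideal P <> P :> nzideal m -> split_primes m (prime_below P).
Proof.
move=> sqf ne; have pp := prime_below_prime P.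
have [x Px nPx] : exists2 x, nzideal_val P x & ~ nzideal_val P x^*.
  apply: contrapT => nex; apply: ne.
  have sub x : nzideal_val P x -> nzideal_val P x^*.
    by move=> Px; apply: contrapT => nPx; apply: nex; exists x.
  apply: nzideal_inj; rewrite eqEsubset; split=> x.
    by move/mem_conjI/sub; rewrite conjCK.
  by move/sub/mem_conjI.
have Ox := ideal_sub (nzideal_ideal P) Px; have Ox' := OKconj Ox.
have /intrP[n en] := OKnorm_int Ox; have /intrP[t et] := OKtrace_int Ox.
have pn : ((prime_below P)%:Z %| n)%Z.
  by apply/mem_int_prime; rewrite -en mulrC; exact: (idealM (nzideal_ideal P)).
have pt : ~~ ((prime_below P)%:Z %| t)%Z.
  apply/negP => /mem_int_prime Pt; apply: nPx.
  by rewrite -(addKr x x^*) et addrC; exact: idealB.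
(* For x = a + b sqrt(-m) this is y = 2b; [square_free_sqr_dvd] shows that the denominator of 2b
   divides its numerator. *)
have [y ey] : exists y : int, - m%:Z * y ^+ 2 = t ^+ 2 - 4 * n.
  case: (Ox) => -[a [b exab]] _.
  have e1 : - m%:R * (2 * b) ^+ 2 = (t ^+ 2 - 4 * n)%:~R :> rat.
    apply: (fmorph_inj (@ratr algC)).
    rewrite /= ratr_int intrB (rmorphXn intr) intrM /= -en -et exab conj_elt.
    rewrite rmorphM rmorphN rmorphXn rmorphM /= !ratr_nat.
    by have e := sqrt_neg_sqr m; ring: e.
  pose q := 2 * b; have eq := divq_num_den q.
  have d0 : denq q != 0 by exact: denq_neq0.
  have d0Q : (denq q)%:~R != 0 :> rat by rewrite intr_eq0.
  have e2 : m%:Z * (numq q) ^+ 2 = (4 * n - t ^+ 2) * (denq q) ^+ 2.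
    apply/eqP; rewrite -(eqr_int rat); apply/eqP.
    rewrite intrM [RHS]intrM !(rmorphXn intr) /= intrB.
    have -> : (4 * n)%:~R - (t ^+ 2)%:~R = m%:R * q ^+ 2 :> rat.
      by move: e1; rewrite intrB -/q => e1; rewrite -[LHS]opprB -e1; ring.
    by rewrite -{2}eq; field.
  have /dvdzP[y ey] := square_free_sqr_dvd sqf d0 e2.
  exists y; apply: (mulIf (expf_neq0 2 d0)).
  by move: e2; rewrite ey exprMn => e2; rewrite !mulNr -mulrA e2; ring.
split=> //; set p := prime_below P in pn pt pp *.
case: ifP => [/eqP p2|p2].
- have podd : (t %% 2)%Z = 1 by move: pt; rewrite p2; lia.
  have [n1 en1] : exists n1, n = 2 * n1 by exists (n %/ 2)%Z; move: pn; rewrite p2; lia.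
  have [t1 et1] : exists t1, t = 2 * t1 + 1 by exists (t %/ 2)%Z; lia.
  have yodd : (y %% 2)%Z = 1.
    apply: contrapT => ny.
    have [y1 ey1] : exists y1, y = 2 * y1 by exists (y %/ 2)%Z; lia.
    move: ey; rewrite ey1 et1 en1 => ey; nia.
  have [y1 ey1] : exists y1, y = 2 * y1 + 1 by exists (y %/ 2)%Z; lia.
  (* Products of consecutive integers are even, so odd squares are 1 modulo 8; here t and y are odd
     and 8 divides 4n. *)
  have tri (z : int) : exists w, z * (z + 1) = 2 * w.
    have [q [->|->]] : exists q, z = 2 * q \/ z = 2 * q + 1.
    - by clear -z; exists (z %/ 2)%Z; lia.
    - by exists (q * (2 * q + 1)); ring.
    - by exists ((2 * q + 1) * (q + 1)); ring.
  have [t2 et2] := tri t1; have [y2 ey2] := tri y1.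
  apply/eqP; rewrite eqz_mod_dvd; apply/dvdzP.
  exists (t2 - n1 + m%:Z * y2); move: ey; rewrite ey1 et1 en1.
  have sq (z : int) : (2 * z + 1) ^+ 2 = 1 + 4 * (z * (z + 1)) by ring.
  by rewrite !sq et2 ey2; lia.
- split.
    apply: contra pt => /dvdnP[k ek].
    have : (p%:Z %| t ^+ 2)%Z.
      have -> : t ^+ 2 = - (m%:Z * y ^+ 2) + 4 * n by rewrite -mulNr ey; ring.
      apply: rpredD; last exact: dvdz_mull.
      by rewrite rpredN; apply: dvdz_mulr; rewrite ek PoszM; exact: dvdz_mull.
    by rewrite !dvdzE abszX Euclid_dvdX // => /andP[].
  have py : coprime p `|y|.
    rewrite prime_coprime //; apply: contra pt => py.
    have : (p%:Z %| t ^+ 2)%Z.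
      have -> : t ^+ 2 = - m%:Z * y ^+ 2 + 4 * n by rewrite ey; ring.
      apply: rpredD; last exact: dvdz_mull.
      by rewrite expr2; apply: dvdz_mull; apply: dvdz_mull.
    by rewrite !dvdzE abszX Euclid_dvdX // => /andP[].
  have /coprimezP[[u v] /= euv] : coprimez p%:Z y by [].
  (* Bezout makes v an inverse of y modulo p, so [t * v] is a square root of -m. *)
  exists (t * v); apply/eqP; rewrite eqz_mod_dvd opprK.
  have /dvdzP[n1 en1] := pn.
  have e3 : v * y = 1 - u * p%:Z by rewrite -euv; ring.
  have e4 : (t * v) ^+ 2 + m%:Z = m%:Z * (1 - (v * y) ^+ 2) + 4 * n * v ^+ 2.
    have : t ^+ 2 = - m%:Z * y ^+ 2 + 4 * n by rewrite ey; ring.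
    by move=> e; rewrite !exprMn e; ring.
  apply/dvdzP; rewrite e4 e3 en1.
  exists (m%:Z * u * (2 - u * p%:Z) + 4 * n1 * v ^+ 2); ring.
Qed.
End PrimesAndClasses.

(** * Twisted valuations and ideal classes *)

Section Twist.
Variable m : nat.
Implicit Types (I J K : nzideal m) (P Q : prime_ideal m).
Local Notation OK := (ring_of_integers m).

(** Both [P] and its conjugate divide (p) and they differ, so their product divides (p). With n the
    norm of [P], comparing norms shows that n^2 divides p^2, while p divides n because n lies in
    [P]; hence n = p. *)
Lemma mul_conj_split P : conj_nzideal P <> P :> nzideal m ->
  ((P : nzideal m) * conj_nzideal P)%g = pid m (prime_below P)%:R.
Proof.
move=> ne; set p := prime_below P; have p0 := prime_gt0 (prime_below_prime P).
have Op := OKnat m p; have pC := natC_neq0 p0.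
have sub Q : prime_below Q = p -> nzideal_val (pid m p%:R) `<=` Q.
  move=> e _ /(mem_pid _ Op pC)[y Oy ->]; rewrite mulrC.
  apply: (idealM (nzideal_ideal Q)) => //; rewrite -[p%:R]/(p%:Z%:~R).
  by apply/mem_int_prime; rewrite e.
have [J eJ] := subI_dvd (sub P (erefl _)).
have subP' := sub (conj_prime P) (prime_below_conj P).
case: (@prime_subM _ (conj_prime P) P J) => [|/prime_sub_eq|/subI_dvd[K eK]].
- by rewrite -eJ.
- by move=> /esym.
set n := ideal_norm P; have n0 : (0 < n)%N := ideal_norm_gt0 P.
have eN : ideal_norm (pid m p%:R) = (p ^ 2)%N.
  apply: (@pid_nat_inj m); rewrite ?ideal_norm_gt0 ?expn_gt0 ?p0 //.
  by rewrite -mul_conjI -pid_conj // conjC_nat -pidM // -natrM.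
have eN2 : (p ^ 2 = n * n * ideal_norm K)%N.
  rewrite -eN eJ eK mulgA ideal_normM; congr (_ * _)%N.
  have -> : ((P : nzideal m) * conj_prime P)%g = pid m n%:R by exact: mul_conjI.
  have nC := natC_neq0 n0; have On := OKnat m n.
  apply: (@pid_nat_inj m); rewrite ?ideal_norm_gt0 ?muln_gt0 ?n0 //.
  by rewrite -mul_conjI -pid_conj // conjC_nat -pidM // -natrM.
have /dvdnP[c ec] : (p %| n)%N.
  have : nzideal_val P n%:Z%:~R.
    apply: (@subI_mul _ P (conj_nzideal P)); rewrite mul_conjI.
    by apply: (mem_pid_int m n n0).2; exact: dvdzz.
  by move/mem_int_prime.
rewrite mul_conjI -/n; congr (pid m _%:R).
have := ideal_norm_gt0 K; move: eN2; rewrite ec expnS expn1 => eN2 K0.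
have : (1 = c * c * ideal_norm K)%N.
  apply/eqP; rewrite -(@eqn_pmul2l (p * p)) ?muln_gt0 ?p0 // muln1.
  by apply/eqP; rewrite [LHS]eN2; ring.
move: K0; set k := ideal_norm K; case: (c) => [|[|c']]; nia.
Qed.

(* Vanishes on conjugation-invariant ideals, so that it only sees the split
   primes dividing I. *)
Definition twist P I : int :=
  (ideal_val P I)%:Z - (ideal_val (conj_prime P) I)%:Z.

Lemma twistM P I J : twist P (I * J)%g = twist P I + twist P J.
Proof. by rewrite /twist !ideal_valM !PoszD; ring. Qed.

Lemma twist_one P : twist P 1%g = 0.
Proof. by rewrite /twist !ideal_val1. Qed.

Lemma twistX P I k : twist P (I ^+ k)%g = k%:Z * twist P I.
Proof. by rewrite /twist !ideal_valX !PoszM; ring. Qed.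

Lemma twist_prod P n (F : 'I_n -> nzideal m) :
  twist P (\prod_(j < n) F j)%g = \sum_(j < n) twist P (F j).
Proof. by rewrite (big_morph (twist P) (twistM P) (twist_one P)). Qed.

Lemma ideal_val_conjr P I : ideal_val P (conj_nzideal I) = ideal_val (conj_prime P) I.
Proof. by rewrite -ideal_val_conj conjIK. Qed.

Lemma twist_conj P I : twist P (conj_nzideal I) = - twist P I.
Proof. by rewrite /twist !ideal_val_conjr /= conjIK opprB. Qed.

Lemma twist_conj_eq P I : conj_nzideal P = P :> nzideal m -> twist P I = 0.
Proof. by move=> e; rewrite /twist /= e subrr. Qed.

Lemma twist_self P : conj_nzideal P <> P :> nzideal m -> twist P P = 1.
Proof.
move=> ne; rewrite /twist !ideal_val_prime eqxx.
by rewrite -[prime_ideal_val (conj_prime P)]/(conj_nzideal P) (introF eqP ne).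
Qed.

Lemma twist_prime_neq P Q : prime_below P <> prime_below Q -> twist P Q = 0.
Proof.
move=> ne; rewrite /twist !ideal_val_prime.
have neq P1 : prime_below P1 = prime_below P -> ((P1 : nzideal m) == Q) = false.
  move=> e; apply/eqP => ePQ; apply: ne; rewrite -e /prime_below.
  by rewrite ePQ.
by rewrite !neq ?subrr //; exact: prime_below_conj.
Qed.

Lemma twist_same_prime P Q : conj_nzideal P <> P :> nzideal m ->
  prime_below P = prime_below Q -> twist P Q = 1 \/ twist P Q = - 1.
Proof.
move=> ne /esym/same_prime_below[] ->; first by left; exact: twist_self.
by right; rewrite twist_conj twist_self.
Qed.

Lemma class_of_idealM I J :
  class_of_ideal (I * J)%g = class_of_ideal I + class_of_ideal J.
Proof. exact: pi_cl_add. Qed.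

Lemma class_of_ideal1 : class_of_ideal (1%g : nzideal m) = 0.
Proof. by rewrite /class_of_ideal /GRing.zero /= /cl_zero; unlock. Qed.

Lemma class_of_conj I : class_of_ideal (conj_nzideal I) = - class_of_ideal I.
Proof. exact: pi_cl_opp. Qed.

Lemma class_of_pid a : OK a -> a != 0 -> class_of_ideal (pid m a) = 0.
Proof.
move=> Oa a0; rewrite -class_of_ideal1; apply/eqP; rewrite /class_of_ideal piE.
apply/asboolP; exists 1, a; split; rewrite ?oner_neq0 //; first exact: OK1.
by rewrite -pid_mulE ?oner_neq0 ?pid1 ?mul1g ?pidE //; exact: OK1.
Qed.

(** Induction over prime factors: conjugate primes have opposite classes and opposite twists, and a
    self-conjugate prime has a class killed by doubling. Allowing every larger [B'] lets the
    induction pass to a bound that also exceeds the new prime. *)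
Lemma class_twist (l : nat -> prime_ideal m) I :
  (forall p, prime p -> prime_below (l p) = p) ->
  exists B, (forall p, prime p -> (B <= p)%N -> twist (l p) I = 0) /\
    forall B', (B <= B')%N -> class_of_ideal I *+ 2
      = \sum_(p < B' | prime p) class_of_ideal (l p) *~ twist (l p) I *+ 2.
Proof.
move=> lP; elim/nzideal_prime_ind: I => [|P I [B [IH0 IH]]].
  exists 0%N; split=> [p _ _|B' _]; first exact: twist_one.
  rewrite class_of_ideal1 mul0rn big1 // => p _.
  by rewrite twist_one mulr0z mul0rn.
set q := prime_below P; have pq : prime q := prime_below_prime P.
exists (maxn B q.+1); split=> [p pp|B']; rewrite geq_max => /andP[hB hq].
  by rewrite twistM IH0 // twist_prime_neq ?addr0 // lP // -/q; lia.
under eq_bigr do rewrite twistM mulrzDr mulrnDl.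
rewrite big_split /= -IH // class_of_idealM mulrnDl; congr (_ + _).
rewrite (bigD1 (Ordinal hq)) //= big1 ?addr0; last first.
  move=> p /andP[pp /eqP ne]; rewrite twist_prime_neq ?mulr0z ?mul0rn // lP //.
  by move=> e; apply: ne; apply: val_inj.
have e : prime_below P = prime_below (l q) by rewrite lP.
case: (pselect (conj_nzideal (l q) = l q :> nzideal m)) => [ec|ne].
  rewrite twist_conj_eq // mulr0z mul0rn mulr2n.
  have -> : (P : nzideal m) = l q by case: (same_prime_below e) => ->.
  by rewrite -{2}ec class_of_conj subrr.
case: (same_prime_below e) => ->; first by rewrite twist_self // mulr1z.
by rewrite twist_conj twist_self // class_of_conj mulrNz mulr1z.
Qed.

End Twist.

(** * Valuations of Pythagorean classes *)

Section PythOrd.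
Variable m : nat.
Implicit Types (I J K : nzideal m) (P Q : prime_ideal m).
Implicit Types (t : ptriple m) (x : pyth_group m).
Local Notation OK := (ring_of_integers m).
Local Notation rt := (sqrt_neg m).

Definition triple_elt (t : int * int * nat) : algC :=
  t.1.1%:~R + t.1.2%:~R * rt.

(** The valuation at [P] of (a + b sqrt(-m)) / c, as a difference because [ideal_val] is only
    defined on integral ideals. *)
Definition triple_ord P (t : int * int * nat) : int :=
  (ideal_val P (pid m (triple_elt t)))%:Z - (ideal_val P (pid m t.2%:R))%:Z.

Lemma OK_triple_elt (t : int * int * nat) : OK (triple_elt t).
Proof. by apply: OKD; [|apply: OKM; [|exact: OK_sqrt_neg]]; exact: OKint. Qed.

Lemma conj_triple_elt (t : int * int * nat) :
  (triple_elt t)^* = t.1.1%:~R - t.1.2%:~R * rt.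
Proof. by rewrite /triple_elt rmorphD rmorphM /= !rmorph_int conj_sqrt_neg mulrN. Qed.

Lemma triple_eltN t : triple_elt t * (triple_elt t)^* = t.2%:R ^+ 2.
Proof.
case: t => [[[a b] c] /andP[/= /eqP e c0]]; rewrite conj_triple_elt /triple_elt /=.
have -> : c%:R ^+ 2 = (c%:Z ^+ 2)%:~R :> algC by rewrite (rmorphXn intr).
rewrite -e intrD intrM !(rmorphXn intr) /=.
by have es := sqrt_neg_sqr m; ring: es.
Qed.

Lemma ptriple_gt0 t : (0 < t.2)%N.
Proof. by case/andP: (ptripleP t). Qed.

Lemma ptriple_neq0 t : (t.2%:R : algC) != 0.
Proof. exact/natC_neq0/ptriple_gt0. Qed.

Lemma triple_elt_neq0 t : triple_elt t != 0.
Proof.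
apply/eqP => e; have := triple_eltN t; rewrite e mul0r => /esym/eqP.
by rewrite expf_eq0 /= (negbTE (ptriple_neq0 t)).
Qed.

Lemma pidN a : OK a -> a != 0 -> pid m (- a) = pid m a.
Proof.
move=> Oa a0; have ON1 : OK (-1) by exact: (OKint m (-1)).
have N10 : -1 != 0 :> algC by rewrite oppr_eq0 oner_neq0.
rewrite -mulN1r pidM //; suff -> : pid m (-1) = 1%g by rewrite mul1g.
apply: nzideal_inj; rewrite eqEsubset; split=> x.
  by move/(mem_pid _ ON1 N10) => [y Oy ->]; exact: OKM.
move=> Ox; apply/(mem_pid _ ON1 N10); exists (- x); last by rewrite mulrNN mul1r.
exact: OKN.
Qed.

Lemma pid_absz (s : int) : s != 0 -> pid m s%:~R = pid m `|s|%N%:R.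
Proof.
have [k [->|->]] : exists k : nat, s = k%:Z \/ s = - k%:Z.
- by exists `|s|%N; lia.
- by rewrite absz_nat.
- move=> s0; rewrite abszN absz_nat rmorphN /= pidN //; first exact: OKnat.
  by rewrite pnatr_eq0; lia.
Qed.

(** The last entry is scaled by the absolute value, so a negative [s] changes the sign of the
    number; ideals do not see signs. *)
Lemma triple_ord_scale P (s : int) t : s != 0 ->
  triple_ord P (scale_triple s t) = triple_ord P t.
Proof.
move=> s0; have sC : s%:~R != 0 :> algC by rewrite intr_eq0.
have Os := OKint m s; have t0 := ptriple_gt0 t.
have Oc := OKnat m t.2; have c0 := ptriple_neq0 t.
rewrite /triple_ord.
have -> : triple_elt (scale_triple s t) = s%:~R * triple_elt t.
  by rewrite /triple_elt /= !intrM; ring.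
have -> : pid m (scale_triple s t).2%:R = (pid m s%:~R * pid m t.2%:R)%g.
  by rewrite /= -pid_absz ?mulf_neq0 //; [rewrite intrM pidM|lia].
rewrite pidM ?triple_elt_neq0 //; last exact: OK_triple_elt.
by rewrite !ideal_valM !PoszD; ring.
Qed.

Definition pyth_ord P x : int := triple_ord P (repr x).

Lemma pyth_ord_pi P t : pyth_ord P (\pi_(pyth_group m) t)%qT = triple_ord P t.
Proof.
have: (t = repr (\pi_(pyth_group m) t) %[mod pyth_group m])%qT by rewrite reprK.
move=> /eqP; rewrite piE => /asboolP[s [r [s0 r0 e]]].
rewrite /pyth_ord -(@triple_ord_scale P s t); last exact/eqP.
by rewrite e triple_ord_scale //; exact/eqP.
Qed.

Lemma pyth_ordD P : {morph pyth_ord P : x y / x + y}.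
Proof.
elim/quotW=> t; elim/quotW=> u; rewrite [LHS](_ : _ = triple_ord P (add_ptriple t u)).
  rewrite !pyth_ord_pi /triple_ord.
  have -> : triple_elt (add_ptriple t u) = triple_elt t * triple_elt u.
    rewrite /triple_elt /= intrB intrD !intrM.
    by have es := sqrt_neg_sqr m; ring: es.
  rewrite pidM ?triple_elt_neq0 //; try exact: OK_triple_elt.
  rewrite /= natrM pidM ?ptriple_neq0 //; try exact: OKnat.
  by rewrite !ideal_valM !PoszD; ring.
by rewrite -pyth_ord_pi; congr pyth_ord; rewrite pi_pyth_add.
Qed.

Lemma pyth_ord_zmod_morphism P : zmod_morphism (pyth_ord P).
Proof.
by move=> x y; apply: (addIr (pyth_ord P y)); rewrite -pyth_ordD !subrK.
Qed.

HB.instance Definition _ P :=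
  GRing.isZmodMorphism.Build (pyth_group m) int (pyth_ord P)
    (@pyth_ord_zmod_morphism P).

End PythOrd.

(** * Orders of Pythagorean classes *)

Section PythOrdTheory.
Variable m : nat.
Implicit Types (I J K : nzideal m) (P Q : prime_ideal m).
Implicit Types (t : ptriple m) (x : pyth_group m).
Local Notation OK := (ring_of_integers m).
Local Notation rt := (sqrt_neg m).

Lemma pyth_pi_eq0 t : (\pi_(pyth_group m) t)%qT = 0 <-> t.1.2 = 0.
Proof.
have -> : (0 : pyth_group m) = (\pi_(pyth_group m) (one_ptriple m))%qT.
  by rewrite /GRing.zero /= /pyth_zero; unlock.
split=> [/eqP|b0]; last (apply/eqP); rewrite piE.
  move=> /asboolP[s [r [s0 r0 [_ e _]]]]; apply/eqP.
  by move/eqP: e; rewrite mulr0 mulf_eq0 => /orP[/eqP|].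
have /andP[/eqP e c0] := ptripleP t; rewrite b0 expr0n mulr0 addr0 in e.
have a0 : t.1.1 <> 0 by move=> a0; rewrite a0 in e; nia.
(* As b = 0 gives |a| = c, the triple is a times (1, 0, 1). *)
apply/asboolP; exists 1, t.1.1; split=> //.
rewrite /scale_triple /= b0 !mulr0 !mulr1 !mul1r; congr (_, _, _).
by nia.
Qed.

(** The number and its conjugate have product 1, and the denominator has the same valuation at both
    primes. *)
Lemma triple_ord_conj P t : triple_ord (conj_prime P) t = - triple_ord P t.
Proof.
have Oe := @OK_triple_elt m t; have e0 := triple_elt_neq0 t.
have Oc := OKnat m t.2; have c0 := ptriple_neq0 t.
have e : (pid m (triple_elt m t) * conj_nzideal (pid m (triple_elt m t))
    = pid m t.2%:R * pid m t.2%:R)%g.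
  rewrite -pid_conj // -pidM ?fmorph_eq0 //; last exact: OKconj.
  by rewrite triple_eltN expr2 pidM.
have := congr1 (ideal_val P) e; rewrite !ideal_valM ideal_val_conjr /triple_ord.
have -> : ideal_val (conj_prime P) (pid m t.2%:R) = ideal_val P (pid m t.2%:R).
  by rewrite -ideal_val_conjr -pid_conj // conjC_nat.
lia.
Qed.

(* Hilbert 90: z = w / conj w with w = 1 + z, here multiplied by the denominator. *)
Lemma triple_ord_twist P t : triple_elt m t + t.2%:R != 0 ->
  triple_ord P t = twist P (pid m (triple_elt m t + t.2%:R)).
Proof.
set w := _ + _ => w0.
have Oe := @OK_triple_elt m t; have e0 := triple_elt_neq0 t.
have Oc := OKnat m t.2; have c0 := ptriple_neq0 t.
have Ow : OK w by exact: OKD.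
have e : triple_elt m t * w^* = t.2%:R * w.
  by rewrite rmorphD /= conjC_nat mulrDr triple_eltN /w; ring.
have := congr1 (fun a => ideal_val P (pid m a)) e.
rewrite !pidM ?fmorph_eq0 //; last exact: OKconj.
rewrite pid_conj // !ideal_valM ideal_val_conjr /triple_ord /twist.
lia.
Qed.

(** By [triple_ord_twist] the coordinates are the twists of a principal ideal; its class is 0, so
    [class_twist] becomes a relation. *)
Lemma pyth_ord_relation (l : nat -> prime_ideal m) x : (0 < m)%N ->
  (forall p, prime p -> prime_below (l p) = p) ->
  exists B, (forall p, prime p -> (B <= p)%N -> pyth_ord (l p) x = 0) /\
    \sum_(p < B | prime p) class_of_ideal (l p) *~ pyth_ord (l p) x *+ 2 = 0.
Proof.
move=> m0 lP; elim/quotW: x => t.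
(* The degenerate case is z = -1, which represents the zero class. *)
have [w0|w0] := eqVneq (triple_elt m t + t.2%:R) 0.
  exists 0%N; rewrite big_ord0; split=> // p _ _.
  have -> : (\pi_(pyth_group m) t)%qT = 0; last exact: raddf0.
  apply/pyth_pi_eq0; have ce : triple_elt m t = (triple_elt m t)^*.
    have -> : triple_elt m t = - t.2%:R by apply/eqP; rewrite -addr_eq0 w0.
    by rewrite rmorphN /= conjC_nat.
  move: ce; rewrite conj_triple_elt /triple_elt => /addrI/eqP.
  rewrite -subr_eq0 opprK -mulr2n mulrn_eq0 /= mulf_eq0 intr_eq0.
  case/orP=> /eqP // rt0; have := sqrt_neg_sqr m.
  by rewrite rt0 mul0r => /esym/eqP; rewrite oppr_eq0 pnatr_eq0; lia.
have Ow : OK (triple_elt m t + t.2%:R) by apply: OKD; [exact: OK_triple_elt|exact: OKnat].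
have [B [B0 eB]] := class_twist (pid m (triple_elt m t + t.2%:R)) lP.
exists B; split=> [p pp pB|].
  by rewrite pyth_ord_pi triple_ord_twist // B0.
have := eB B (leqnn B); rewrite class_of_pid // mul0rn => /esym.
by under eq_bigr do rewrite -triple_ord_twist // -pyth_ord_pi.
Qed.

(** Equality of ideals puts z in [OK]; its integral trace k satisfies 2a = kc, so m (2b)^2 = (4 -
    k^2) c^2 and 2b = rc with m r^2 = 4 - k^2. A nonzero r forces m = 4, which is not
    square-free. *)
Lemma unit_triple t : (3 < m)%N -> square_free m ->
  pid m (triple_elt m t) = pid m t.2%:R -> t.1.2 = 0.
Proof.
move=> hm sqf e.
have Oe := @OK_triple_elt m t; have e0 := triple_elt_neq0 t.
have Oc := OKnat m t.2; have c0 := ptriple_neq0 t.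
have : nzideal_val (pid m (triple_elt m t)) (triple_elt m t).
  by apply/mem_pid => //; exists 1; [exact: OK1|rewrite mulr1].
rewrite e => /(mem_pid _ Oc c0)[y Oy ey].
have /intrP[k ek] := OKtrace_int Oy.
have e2 : 2 * t.1.1 = t.2%:Z * k.
  apply/eqP; rewrite -(eqr_int algC) !intrM -ek; apply/eqP.
  have := congr1 Num.conj ey; rewrite rmorphM /= conjC_nat => ey'.
  rewrite mulrDr -[_%:~R in RHS]/(t.2%:R) -ey -ey' conj_triple_elt /triple_elt.
  by rewrite -[2%:~R]/(2 : algC); ring.
have /andP[/eqP et c1] := ptripleP t; move: et e2 c1.
move: (t.1.1) (t.1.2) (t.2) => a b c et e2 c1.
have e3 : m%:Z * (2 * b) ^+ 2 = (4 - k ^+ 2) * c%:Z ^+ 2.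
  have : (c%:Z * k) ^+ 2 = (2 * a) ^+ 2 by rewrite e2.
  move=> e4; rewrite mulrBl -exprMn (mulrC k) e4 -et.
  by ring.
have cz : c%:Z != 0 by lia.
have /dvdzP[r er] := square_free_sqr_dvd sqf cz e3.
have {}e3 : m%:Z * r ^+ 2 = 4 - k ^+ 2.
  apply: (mulIf (expf_neq0 2 cz)).
  by rewrite -e3 er; ring.
have [r0|r0] := eqVneq r 0; first by move: er; rewrite r0 mul0r; lia.
have r1 : 1 <= r ^+ 2 by rewrite expr2; nia.
have k2 : 0 <= k ^+ 2 by exact: sqr_ge0.
have m4 : m = 4%N by nia.
by have := sqf 2; rewrite m4 => /(_ isT).
Qed.

(** Valuations change sign under conjugation, so they vanish at self-conjugate primes, and any other
    prime is some [l p] or its conjugate. Numerator and denominator then generate the same ideal. *)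
Lemma pyth_ord_inj (l : nat -> prime_ideal m) x : (3 < m)%N -> square_free m ->
  (forall p, prime p -> prime_below (l p) = p) ->
  (forall p, split_primes m p -> pyth_ord (l p) x = 0) -> x = 0.
Proof.
move=> hm sqf lP; elim/quotW: x => t t0.
apply/pyth_pi_eq0; apply: unit_triple => //; apply: ideal_val_inj => P.
suff : triple_ord P t = 0 by rewrite /triple_ord; lia.
case: (pselect (conj_nzideal P = P :> nzideal m)) => [e|ne].
  have := triple_ord_conj P t; rewrite /triple_ord /= e.
  lia.
have sp := conj_neq_split sqf ne.
have := t0 _ sp; rewrite pyth_ord_pi => t0p.
have e : prime_below P = prime_below (l (prime_below P)).
  by rewrite lP //; exact: prime_below_prime.
case: (same_prime_below e) => eP; first by rewrite /triple_ord eP.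
have := triple_ord_conj (l (prime_below P)) t.
by rewrite t0p oppr0 /triple_ord eP.
Qed.

Lemma ideal_norm_conj I : ideal_norm (conj_nzideal I) = ideal_norm I.
Proof.
apply: (@pid_nat_inj m); rewrite ?ideal_norm_gt0 // -!mul_conjI conjIK.
exact: mulIC.
Qed.

Lemma ideal_norm_split P : conj_nzideal P <> P :> nzideal m ->
  ideal_norm P = prime_below P.
Proof.
move=> ne; apply: (@pid_nat_inj m); rewrite ?ideal_norm_gt0 //.
  exact: prime_gt0 (prime_below_prime P).
by rewrite -mul_conjI mul_conj_split.
Qed.

Lemma ideal_norm1 : ideal_norm (1%g : nzideal m) = 1%N.
Proof.
have := ideal_normM (1%g : nzideal m) 1%g; rewrite mulg1.
by have := ideal_norm_gt0 (1%g : nzideal m); nia.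
Qed.

Lemma ideal_normX I k : ideal_norm (I ^+ k)%g = (ideal_norm I ^ k)%N.
Proof.
elim: k => [|k IHk]; first by rewrite expg0 ideal_norm1.
by rewrite expgS ideal_normM IHk expnS.
Qed.

Lemma ideal_norm_prod n (F : 'I_n -> nzideal m) :
  ideal_norm (\prod_(j < n) F j)%g = (\prod_(j < n) ideal_norm (F j))%N.
Proof. by rewrite (big_morph (@ideal_norm m) (@ideal_normM m) ideal_norm1). Qed.

(** The power of 2 cancels; what remains of the numerator generates [J ^+ 2] and of the denominator
    [J * conj J], with quotient J / conj J. *)
Lemma triple_ord_square P J t (u v : int) c :
  (J ^+ 2)%g = principal m (integer_elt m u v) :> set algC ->
  ptriple_val t = (u, v, (2 ^ (1 - delta m) * c)%N) -> ideal_norm J = c ->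
  triple_ord P t = twist P J.
Proof.
move=> eJ et eN; set k := (2 ^ (1 - delta m))%N in et.
have k0 : (0 < k)%N by rewrite expn_gt0.
have Ok := OKnat m k; have kC := natC_neq0 k0.
set a := integer_elt m u v in eJ.
have ea : triple_elt m t = k%:R * a.
  by rewrite et /triple_elt /a /integer_elt /= -natrX [RHS]mulrC divfK.
have Oa : OK a.
  apply: (ideal_sub (nzideal_ideal (J ^+ 2)%g)); rewrite eJ.
  by exists 1; [exact: OK1|rewrite mulr1].
have a0 : a != 0.
  by have := triple_elt_neq0 t; rewrite ea mulf_eq0 negb_or => /andP[].
have {}eJ : (J ^+ 2)%g = pid m a by apply: nzideal_inj; rewrite eJ pidE.
have c0 : (0 < c)%N by rewrite -eN ideal_norm_gt0.
rewrite /triple_ord ea pidM // et /= natrM pidM ?natC_neq0 //; last exact: OKnat.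
rewrite -eJ -eN -mul_conjI expgS expg1 /twist !ideal_valM ideal_val_conjr.
lia.
Qed.

(** Changing both signs is scaling by -1; changing one gives, up to scaling, the conjugate, that is,
    the opposite class. *)
Lemma is_class_abs x (u v : int) c : is_class x `|u| `|v| c ->
  exists2 t : ptriple m, ptriple_val t = (u, v, c) &
    x = (\pi_(pyth_group m) t)%qT \/ x = - (\pi_(pyth_group m) t)%qT.
Proof.
move=> [t0 et0 ->].
have tP : is_ptriple m (u, v, c).
  have := ptripleP t0; rewrite et0 /is_ptriple /=.
  by rewrite !real_normK ?num_real.
exists (PTriple tP) => //.
have eqpi t1 t2 (s : int) : s <> 0 -> scale_triple 1 t1 = scale_triple s t2 ->
    (\pi_(pyth_group m) t1)%qT = (\pi_(pyth_group m) t2)%qT.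
  by move=> s0 e; apply/eqP; rewrite piE; apply/asboolP; exists 1, s.
have -> : - (\pi_(pyth_group m) (PTriple tP))%qT
    = (\pi_(pyth_group m) (opp_ptriple (PTriple tP)))%qT.
  by rewrite pi_pyth_opp.
case: (lerP 0 u) => u0; case: (lerP 0 v) => v0.
- left; apply: (eqpi _ _ 1) => //; rewrite et0 /=.
  by rewrite !ger0_norm.
- right; apply: (eqpi _ _ 1) => //; rewrite et0 /= /opp_triple /=.
  by rewrite (ger0_norm u0) (ltr0_norm v0).
- right; apply: (eqpi _ _ (-1)) => //; rewrite et0 /= /opp_triple /scale_triple /=.
  by rewrite (ger0_norm v0) (ltr0_norm u0) !mul1r !mulN1r opprK abszN absz_nat mul1n.
- left; apply: (eqpi _ _ (-1)) => //; rewrite et0 /scale_triple /=.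
  by rewrite !ltr0_norm // !mul1r !mulN1r abszN absz_nat mul1n.
Qed.

Lemma pyth_ord_abs x (t : ptriple m) :
  x = (\pi_(pyth_group m) t)%qT \/ x = - (\pi_(pyth_group m) t)%qT ->
  exists2 e : int, e = 1 \/ e = -1 &
    forall P, pyth_ord P x = e * triple_ord P t.
Proof.
case=> ->; [exists 1; first by left|exists (-1); first by right];
  by move=> P; rewrite ?raddfN /= pyth_ord_pi ?mul1r ?mulN1r.
Qed.

(** The number is w / p with w integral of norm p^2, so only primes over p matter. At [l p] the
    valuation of w is at most 2 and that of p is 1, which leaves -1, 0 and 1; the value 0 would make
    the class trivial, against b > 0. *)
Lemma beta_L0_ord (l : nat -> prime_ideal m) p x : (3 < m)%N -> square_free m ->
  (forall p, prime p -> prime_below (l p) = p) ->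
  split_primes m p -> beta_on_L0 p x ->
  (forall q, prime q -> q <> p -> pyth_ord (l q) x = 0)
  /\ (pyth_ord (l p) x = 1 \/ pyth_ord (l p) x = -1).
Proof.
move=> hm sqf lP sp [a [b [a0 b0 H]]]; have pp : prime p by case: sp.
have [t [k [k0 k2 et ->]]] : exists (t : ptriple m) (k : nat), [/\ (0 < k)%N,
    (k %| 2)%N, ptriple_val t = (a%:Z, b%:Z, (k * p)%N) & x = (\pi_(pyth_group m) t)%qT].
  case: H => -[_ [t et ex]]; exists t; [exists 1%N|exists 2%N]; split=> //.
  by rewrite mul1n.
have {H} kC := natC_neq0 k0.
have pC := natC_neq0 (prime_gt0 pp); have Op := OKnat m p.
have [w ea Kw] : exists2 w, triple_elt m t = k%:R * w & quadratic_field m w.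
  exists (triple_elt m t / k%:R); first by rewrite [RHS]mulrC divfK.
  apply: KM; first by case: (@OK_triple_elt m t).
  by rewrite -ratr_nat -fmorphV; exact: Krat.
have ew : w * w^* = p%:R ^+ 2.
  apply: (mulfI (expf_neq0 2 kC)).
  transitivity (triple_elt m t * (triple_elt m t)^*).
    by rewrite ea (rmorphM Num.conj) /= conjC_nat; ring.
  by rewrite triple_eltN et /= natrM exprMn.
have [k' ek'] := dvdnP k2.
(* The trace of w is 2a / k, with k equal to 1 or 2 according to the denominator p or 2p; [k'] is 2
   / k. *)
have ewt : w + w^* = (k'%:Z * a%:Z)%:~R.
  apply: (mulfI kC); transitivity (triple_elt m t + (triple_elt m t)^*).
    by rewrite ea (rmorphM Num.conj) /= conjC_nat; ring.
  rewrite conj_triple_elt /triple_elt et /= intrM mulrA -[k'%:~R]/(k'%:R : algC).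
  by rewrite -natrM mulnC -ek'; ring.
have Ow : OK w.
  apply: (@OK_quadratic _ _ (k'%:Z * a%:Z) (p%:Z ^+ 2)) => //.
  have -> : (p%:Z ^+ 2)%:~R = p%:R ^+ 2 :> algC by rewrite (rmorphXn intr).
  by rewrite -ewt -ew; ring.
have w0 : w != 0.
  by have := triple_elt_neq0 t; rewrite ea mulf_eq0 negb_or => /andP[].
have ordE P : triple_ord P t
    = (ideal_val P (pid m w))%:Z - (ideal_val P (pid m p%:R))%:Z.
  rewrite /triple_ord ea et /= natrM !pidM //; try exact: OKnat.
  by rewrite !ideal_valM; lia.
have valE P : (ideal_val P (pid m w) <= 2 * ideal_val P (pid m p%:R))%N.
  have := congr1 (fun a => ideal_val P (pid m a)) ew.
  rewrite expr2 !pidM ?fmorph_eq0 //; last exact: OKconj.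
  by rewrite !ideal_valM; lia.
have off q : prime q -> q <> p -> pyth_ord (l q) (\pi_(pyth_group m) t)%qT = 0.
  move=> pq ne; rewrite pyth_ord_pi ordE; have := valE (l q).
  suff -> : ideal_val (l q) (pid m p%:R) = 0%N by lia.
  apply/ideal_val_eq0 => sub; apply: ne.
  have : nzideal_val (l q) p%:Z%:~R.
    by apply: sub; apply: (mem_pid_int m p (prime_gt0 pp)).2; exact: dvdzz.
  move/mem_int_prime; rewrite lP // dvdzE /= dvdn_prime2 //.
  by move/eqP.
split=> //.
have nz : pyth_ord (l p) (\pi_(pyth_group m) t)%qT != 0.
  apply/eqP => op; have : (\pi_(pyth_group m) t)%qT = 0.
    apply: (pyth_ord_inj hm sqf lP) => q sq.
    have [->//|/eqP ne] := eqVneq q p; apply: off => //; by case: sq.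
  by move/pyth_pi_eq0; rewrite et /=; lia.
move: nz; rewrite pyth_ord_pi ordE; have := valE (l p).
have ne : conj_nzideal (l p) <> l p :> nzideal m.
  by apply: split_conj_neq; rewrite lP.
have -> : ideal_val (l p) (pid m p%:R) = 1%N.
  have := mul_conj_split ne; rewrite lP // => <-.
  rewrite ideal_valM ideal_val_self ideal_val_conjr ideal_val_prime.
  by rewrite -[prime_ideal_val (conj_prime _)]/(conj_nzideal (l p)) (introF eqP ne).
move: (ideal_val _ _) => i; lia.
Qed.

End PythOrdTheory.

(** * Bases from coordinates *)

Section Basis.
Variable V : zmodType.

(** Merges repeated vectors: [is_basis] asks for a list without repetitions, while values of [beta]
    might a priori coincide. *)
Lemma uniq_combination (B : set V) (r : seq (V * int)) :
  (forall z, z \in r -> B z.1) ->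
  exists (s : seq V) (k : V -> int),
    [/\ uniq s, forall x, x \in s -> B x
      & \sum_(z <- r) z.1 *~ z.2 = \sum_(x <- s) x *~ k x].
Proof.
move=> rB; exists (undup (map fst r)), (fun x => \sum_(z <- r | z.1 == x) z.2).
split; first exact: undup_uniq.
  by move=> x; rewrite mem_undup => /mapP[z zr ->]; exact: rB.
have mulrz_sum (x : V) (Q : pred (V * int)) :
    x *~ (\sum_(z <- r | Q z) z.2) = \sum_(z <- r | Q z) x *~ z.2.
  by apply: (big_morph _ (mulrzDr x)); rewrite mulr0z.
under [RHS]eq_bigr do rewrite mulrz_sum.
rewrite (exchange_big_dep predT) //= [LHS]big_seq [RHS]big_seq.
apply: eq_bigr => z zr; rewrite big_mkcond /=.
rewrite (bigD1_seq z.1) ?undup_uniq ?mem_undup ?map_f //= eqxx.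
by rewrite big1 ?addr0 // => x; rewrite eq_sym => /negbTE ->.
Qed.

Variables (L D : set nat) (e : nat -> {additive V -> int}) (beta : nat -> V).
Hypothesis DL : D `<=` L.
Hypothesis e_finite :
  forall x, exists B, forall p, L p -> (B <= p)%N -> e p x = 0.
Hypothesis e_inj : forall x, (forall p, L p -> e p x = 0) -> x = 0.
Hypothesis e_unit : forall p, L p -> ~ D p ->
  e p (beta p) = 1 \/ e p (beta p) = -1.
Hypothesis e_neq0 : forall p, D p -> e p (beta p) <> 0.
Hypothesis e_off : forall p q, L p -> L q -> q <> p -> ~ D q \/ D p ->
  e q (beta p) = 0.
Hypothesis e_dvd : forall y, (forall p, L p -> ~ D p -> e p y = 0) ->
  forall p, D p -> (e p (beta p) %| e p y)%Z.

Lemma coordinates_combination q (r : seq nat) (a : pred nat) (k : nat -> int) :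
  L q -> uniq r -> (forall p, a p -> L p) ->
  (forall p, a p -> p <> q -> ~ D q \/ D p) ->
  e q (\sum_(p <- r | a p) beta p *~ k p)
  = if (q \in r) && a q then e q (beta q) * k q else 0.
Proof.
move=> Lq ur aL aD; rewrite raddf_sum /=.
have off p : a p -> p != q -> e q (beta p *~ k p) = 0.
  move=> ap /eqP ne; rewrite raddfMz /= e_off ?mul0rz //; first exact: aL.
    by move=> eqp; apply: ne.
  exact: aD.
case: ifP => [/andP[qr aq]|nq].
  rewrite big_mkcond (bigD1_seq q) //= aq big1 ?addr0 ?raddfMz ?mulrzr //=.
    by rewrite mulrzz.
  by move=> p ne; case: ifP => // ap; exact: off.
rewrite big_seq_cond big1 // => p /andP[pr ap]; apply: off => //.
by apply: contraFN nq => /eqP <-; rewrite pr.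
Qed.

(** The matrix of the [e q (beta p)] is block triangular: off the diagonal only entries with q in
    [D] and p outside [D] may be nonzero. Coefficients of a relation thus vanish first outside [D],
    then on [D]. For generation, the coordinates outside [D] are cleared first, and [e_dvd] permits
    division on [D]. *)
Lemma basis_of_coordinates : is_basis (beta @` L).
Proof.
split.
  move=> s k us sB sum0.
  have [g gP] : exists g : V -> nat, forall x, x \in s -> L (g x) /\ beta (g x) = x.
    have /choice[g gP] : forall x, exists p, x \in s -> L p /\ beta p = x.
      by move=> x; case: (boolP (x \in s)) => [/sB[p Lp ex]|_];
        [exists p|exists 0%N].
    by exists g.
  have gne x y : x \in s -> y \in s -> x != y -> g x <> g y.
    by move=> /gP[_ ex] /gP[_ ey] /eqP ne eg; apply: ne; rewrite -ex -ey eg.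
  have eq0 x : x \in s -> (forall y, y \in s -> k y <> 0 -> ~ D (g x) \/ D (g y)) ->
      e (g x) x * k x = 0.
    move=> xs H; have := congr1 (e (g x)) sum0; rewrite raddf0 raddf_sum /=.
    rewrite (bigD1_seq x) //= big_seq_cond big1 ?addr0; last first.
      move=> y /andP[ys ne]; rewrite raddfMz /=.
      have [->|/eqP k0] := eqVneq (k y) 0; first by rewrite mulr0z.
      have [Ly ey] := gP y ys; have [Lx _] := gP x xs.
      by rewrite -{1}ey e_off ?mul0rz //; [apply: gne; rewrite // eq_sym|exact: H].
    by rewrite raddfMz /= mulrzz.
  have kD x : x \in s -> ~ D (g x) -> k x = 0.
    move=> xs nD; have [Lx ex] := gP x xs.
    have := eq0 x xs (fun _ _ _ => or_introl nD).
    by have := e_unit Lx nD; rewrite ex => -[] ->; rewrite ?mul1r ?mulN1r //; lia.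
  move=> x xs; case: (pselect (D (g x))) => [Dx|]; last exact: kD.
  have [Lx ex] := gP x xs.
  have : e (g x) x * k x = 0.
    apply: eq0 => // y ys ky; right; apply: contrapT => nD.
    by apply: ky; exact: kD.
  move=> /eqP; rewrite mulf_eq0 => /orP[/eqP|/eqP //].
  by have := e_neq0 Dx; rewrite ex.
move=> x; have [B hB] := e_finite x.
pose a p := `[< L p >] && ~~ `[< D p >].
(* Outside [D] the diagonal entry is 1 or -1, so multiplying by it is dividing by it. *)
pose k p := e p x * e p (beta p).
pose y := x - \sum_(p <- iota 0 B | a p) beta p *~ k p.
have yD p : L p -> ~ D p -> e p y = 0.
  move=> Lp nD; rewrite raddfB /= coordinates_combination ?iota_uniq //; last first.
  - by move=> q _ _; left.
  - by move=> q /andP[/asboolP].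
  rewrite mem_iota /= add0n /a (introT (asboolP _) Lp) (introF (asboolP _) nD).
  rewrite andbT; case: ltnP => pB; last by rewrite hB ?subr0.
  by rewrite /k; case: (e_unit Lp nD) => ->; ring.
have [B' hB'] := e_finite y.
(* For p in [D] this division is exact by [e_dvd], since [y] has no coordinates outside [D]. *)
pose k' p := (e p y %/ e p (beta p))%Z.
have ey : y = \sum_(p <- iota 0 B' | `[< D p >]) beta p *~ k' p.
  apply/eqP; rewrite -subr_eq0; apply/eqP/e_inj => p Lp.
  rewrite raddfB /= coordinates_combination ?iota_uniq //; last first.
  - by move=> q /asboolP Dq _; right.
  - by move=> q /asboolP; exact: DL.
  rewrite mem_iota /= add0n; case: (pselect (D p)) => [Dp|nD]; last first.
    by rewrite (introF (asboolP _) nD) andbF yD ?subr0.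
  rewrite (introT (asboolP _) Dp) andbT; case: ltnP => pB; last first.
    by rewrite hB' ?subr0.
  by rewrite /k' mulrC divzK ?subrr //; exact: e_dvd.
have ex : x = \sum_(z <- [seq (beta p, k p) | p <- iota 0 B & a p]
    ++ [seq (beta p, k' p) | p <- iota 0 B' & `[< D p >]]) z.1 *~ z.2.
  by rewrite big_cat /= !big_map !big_filter /= -ey /y addrC subrK.
have [|s [c [us sB es]]] := @uniq_combination (beta @` L)
  ([seq (beta p, k p) | p <- iota 0 B & a p]
    ++ [seq (beta p, k' p) | p <- iota 0 B' & `[< D p >]]).
  move=> z; rewrite mem_cat => /orP[] /mapP[p + ->] /=; rewrite mem_filter.
    by case/andP => /andP[/asboolP Lp _] _; exists p.
  by case/andP => /asboolP Dp _; exists p => //; exact: DL.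
by exists s, c; split=> //; rewrite -es -ex.
Qed.

End Basis.

(** * The coordinates of the generators *)

Lemma two_torsionP (V : zmodType) (x : V) :
  reflect (x *+ 2 = 0) (x \in two_torsion V).
Proof. by rewrite inE; exact: eqP. Qed.

(** * Generators in a direct product of cyclic groups *)

Section CyclicDecomposition.
Variables (W : zmodType) (n : nat) (G : 'I_n -> set W) (h : 'I_n -> nat).
Variable (r : 'I_n -> W).
Hypothesis G_product : internal_direct_product G.
Hypothesis G_cyclic : forall j, cyclic_of_order (G j) (h j).
Hypothesis r_generates : forall j, G j = cycle_of (r j).

Lemma cyclic_order_gt0 j : (0 < h j)%N.
Proof. by have [g _ []] := G_cyclic j. Qed.

(** [h j] is the order of some generator g, which is a multiple of [r j]; so k kills g as well, and
    division with remainder concludes. *)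
Lemma generator_dvd j (k : int) : r j *~ k = 0 -> ((h j)%:Z %| k)%Z.
Proof.
move=> rk; have [g eG [h0 gh gmin]] := G_cyclic j.
have [t _ eg] : cycle_of (r j) g by rewrite -r_generates eG; exists 1.
have gk : g *~ k = 0 by rewrite -eg -mulrzA mulrC mulrzA rk mul0rz.
apply/dvdz_mod0P.
have r0 : (0 <= k %% (h j)%:Z)%Z by rewrite modz_ge0; lia.
have rh : (k %% (h j)%:Z < (h j)%:Z)%Z by rewrite ltz_mod; lia.
have : g *~ (k %% (h j)%:Z)%Z = 0.
  have := gk; rewrite {1}(divz_eq k (h j)%:Z) mulrzDr mulrC mulrzA -pmulrn gh.
  by rewrite mul0rz add0r.
case: (k %% (h j)%:Z)%Z r0 rh => // i _ ih; rewrite -pmulrn => gi.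
by case: i ih gi => // i ih gi; case: (gmin i.+1).
Qed.

Lemma generator_neq0 j : (1 < h j)%N -> r j <> 0.
Proof.
move=> h1 r0; have := @generator_dvd j 1; rewrite r0 mul0rz => /(_ erefl).
by rewrite dvdzE /= dvdn1; lia.
Qed.

Lemma cyclic_factor0 j : G j 0.
Proof. by rewrite r_generates; exists 0; rewrite ?mulr0z. Qed.

Lemma direct_sum_eq0 (y : {ffun 'I_n -> W}) :
  (forall j, G j (y j)) -> \sum_j y j = 0 -> forall j, y j = 0.
Proof.
move=> Gy y0 j; have [z [_ uz]] := G_product 0.
have -> : y = [ffun=> 0]; last by rewrite ffunE.
rewrite -(uz y) ?y0 //; apply: uz; split=> [i|]; first by rewrite ffunE; exact: cyclic_factor0.
by rewrite big1 // => i _; rewrite ffunE.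
Qed.

(** Otherwise [r j] would lie in two different factors, and [r j - r j] would be a second
    decomposition of 0. *)
Lemma generator_inj i j (s : int) : (1 < h j)%N -> r i = r j *~ s -> r j = r i *~ s ->
  i = j.
Proof.
move=> h1 eij eji; apply/eqP; apply: contraT => ne; case: (generator_neq0 h1).
pose y : {ffun 'I_n -> W} := [ffun a => if a == j then r j else if a == i then - r j else 0].
have := @direct_sum_eq0 y _ _ j; rewrite ffunE eqxx; apply.
  move=> a; rewrite ffunE; case: eqVneq => [->|_].
    by rewrite r_generates; exists 1.
  case: eqVneq => [->|_]; last exact: cyclic_factor0.
  by rewrite r_generates; exists (- s); rewrite // mulrNz -eji.
rewrite (bigD1 j) //= (bigD1 i) //= big1 ?addr0; last first.
  by move=> a /andP[aj ai]; rewrite ffunE (negbTE aj) (negbTE ai).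
by rewrite !ffunE !eqxx (negbTE ne) subrr.
Qed.

End CyclicDecomposition.

(** * Coordinates of the classes beta(p) *)

Section Coordinates.
Variable m : nat.
Hypothesis hm : (3 < m)%N.
Hypothesis sqf : square_free m.
Variable l : nat -> prime_ideal m.
Hypothesis lP : forall p : nat, prime p -> prime_below (l p) = p.
Variables (n : nat) (G : 'I_n -> set (class_group_mod_E m)) (h : 'I_n -> nat).
Hypothesis G_product : internal_direct_product G.
Hypothesis G_cyclic : forall j, cyclic_of_order (G j) (h j).
Variable P : 'I_n -> prime_ideal m.
Hypothesis P_generates : forall j, G j = cycle_of (rho (class_of_ideal (P j))).

Local Notation L := (split_primes m).
Let q j := prime_below (P j).
(** When [h j = 1], the class of [P j] is only known to lie in E, so [P j] may lie over a nonsplit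
    prime or share its prime below with another such [P i]; only nontrivial factors are recorded. *)
Let D : set nat := [set p | exists2 j, p = q j & (1 < h j)%N].

Lemma rho_zmod_morphism : zmod_morphism (@rho m).
Proof. exact: (pi_is_zmod_morphism (class_group_mod_E m)). Qed.

HB.instance Definition _ :=
  GRing.isZmodMorphism.Build (class_group m) (class_group_mod_E m) (@rho m)
    rho_zmod_morphism.

Lemma rho_eq0 (x : class_group m) : rho x = 0 <-> x *+ 2 = 0.
Proof.
have rhoP : (rho x = 0) <-> (x \in two_torsion (class_group m)).
  rewrite -{2}[x]subr0 Quotient.idealrBE /rho.
  have -> : (0 : class_group_mod_E m) = rho 0 by rewrite raddf0.
  by split=> /eqP.
exact: iff_trans rhoP (iff_sym (rwP (two_torsionP x))).
Qed.

Lemma conj_neq_of_class (Q : prime_ideal m) :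
  rho (class_of_ideal Q) <> 0 -> conj_nzideal Q <> Q :> nzideal m.
Proof.
move=> nz e; apply: nz; apply/rho_eq0; rewrite mulr2n -{1}e class_of_conj.
exact: addNr.
Qed.

Lemma lifting_conj_neq p : L p -> conj_nzideal (l p) <> l p :> nzideal m.
Proof. by move=> Lp; apply: split_conj_neq; rewrite lP //; case: Lp. Qed.

Lemma generator_conj_neq j : (1 < h j)%N -> conj_nzideal (P j) <> P j :> nzideal m.
Proof.
move=> h1; apply: conj_neq_of_class.
exact: (generator_neq0 G_cyclic P_generates h1).
Qed.

Lemma rho_same_prime (Q Q' : prime_ideal m) : prime_below Q = prime_below Q' ->
  exists2 s : int, s = 1 \/ s = -1 &
    rho (class_of_ideal Q) = rho (class_of_ideal Q') *~ s.
Proof.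
case/same_prime_below => ->; first by exists 1; [left|].
by exists (-1); [right|rewrite class_of_conj raddfN mulrN1z].
Qed.

(** Primes over the same p are equal or conjugate, so modulo E their classes are multiples of each
    other, and [generator_inj] applies. *)
Lemma generator_below_inj i j : (1 < h j)%N -> q i = q j -> i = j.
Proof.
move=> h1 e; have [s s1 es] := rho_same_prime e.
apply: (generator_inj G_product G_cyclic P_generates h1 es).
by rewrite es; case: s1 => ->; rewrite -mulrzA.
Qed.

Lemma D_split p : D p -> L p.
Proof. by move=> [j -> h1]; apply: conj_neq_split => //; exact: generator_conj_neq. Qed.

(** A class in E would make the generator of a nontrivial factor vanish; so the first case of
    [beta_spec] never occurs on [D]. *)
Lemma D_not_L0 p : D p -> ~ split_primes0 l p.
Proof.
move=> [j ep h1] [[pp _]] /two_torsionP/rho_eq0 e.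
have [|s _ es] := @rho_same_prime (P j) (l p); first by rewrite lP.
by case: (generator_neq0 G_cyclic P_generates h1); rewrite /= es e mul0rz.
Qed.

Lemma pyth_ord_nonsplit p x : prime p -> ~ L p -> pyth_ord (l p) x = 0.
Proof.
move=> pp nL; elim/quotW: x => t; rewrite pyth_ord_pi.
have e : conj_nzideal (l p) = l p :> nzideal m.
  by apply: contrapT => /(conj_neq_split sqf); rewrite lP.
by have := triple_ord_conj (l p) t; rewrite /triple_ord /= e; lia.
Qed.

(** Modulo E, the relation of [pyth_ord_relation] retains only primes of [D], where each class is up
    to sign the generator of one factor. As the product is direct, each term vanishes separately and
    its coefficient is divisible by the order. *)
Lemma rho_relation y : (forall p, L p -> ~ D p -> pyth_ord (l p) y = 0) ->
  forall j, (1 < h j)%N -> ((h j)%:Z %| pyth_ord (l (q j)) y)%Z.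
Proof.
move=> y0 j0 h0; pose F p := rho (class_of_ideal (l p)) *~ pyth_ord (l p) y.
have m0 : (0 < m)%N by lia.
have [B [yB rel]] := pyth_ord_relation y m0 lP.
have F0 p : prime p -> ~ D p -> F p = 0.
  move=> pp nD; rewrite /F; case: (pselect (L p)) => [Lp|nL].
    by rewrite y0 ?mulr0z.
  by rewrite pyth_ord_nonsplit ?mulr0z.
have pq j : prime (q j) by exact: prime_below_prime.
have sumF : \sum_(p < B | prime p) F p = 0.
  have /rho_eq0 : (\sum_(p < B | prime p)
      class_of_ideal (l p) *~ pyth_ord (l p) y) *+ 2 = 0 by rewrite -sumrMnl.
  by rewrite raddf_sum /=; under eq_bigr do rewrite raddfMz.
pose Y := [ffun j => if (1 < h j)%N then F (q j) else 0].
have qP j : exists2 s : int, s = 1 \/ s = -1 &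
    rho (class_of_ideal (l (q j))) = rho (class_of_ideal (P j)) *~ s.
  by apply: rho_same_prime; rewrite lP.
have Yj : Y j0 = 0.
  apply: (direct_sum_eq0 G_product P_generates) => [j|].
    rewrite ffunE P_generates; case: ifP => _; last by exists 0; rewrite ?mulr0z.
    by have [s _ es] := qP j; rewrite /F es -mulrzA; exists (s * pyth_ord (l (q j)) y).
  rewrite -[RHS]sumF.
  (* Regroups by primes: each p in [D] is [q j] for exactly one j with [1 < h j], and a [q j] not
     below [B] has coordinate 0. *)
  transitivity (\sum_(j < n) \sum_(p < B | prime p && ((p == q j :> nat) && (1 < h j)%N)) F p).
    apply: eq_bigr => j _; rewrite ffunE; case: ifP => hj; last first.
      by rewrite big_pred0 // => p; rewrite !andbF.
    case: (ltnP (q j) B) => qB; last first.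
      rewrite /F yB // mulr0z big_pred0 // => p; rewrite andbT.
      by have := ltn_ord p; case: eqP; rewrite ?andbF //; lia.
    rewrite (big_pred1 (Ordinal qB)) // => p /=; rewrite andbT -val_eqE /=.
    by case: eqP => [->|]; rewrite ?pq ?andbF.
  rewrite (exchange_big_dep (fun p : 'I_B => prime p)) /=; last first.
    by move=> j p _ /andP[].
  apply: eq_bigr => p pp; rewrite (eq_bigl (fun j => (p == q j :> nat) && (1 < h j)%N)).
    case: (pselect (D p)) => [[j ep hj]|nD].
      rewrite (big_pred1 j) // => i /=; apply/andP/eqP => [[/eqP ei hi]|->].
        by apply: generator_below_inj => //; rewrite -ei.
      by rewrite ep eqxx.
    rewrite F0 // big1 //.
  by move=> j /=; rewrite pp.
move: Yj; rewrite ffunE h0 /F; have [s s1 ->] := qP j0; rewrite -mulrzA.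
move=> /(generator_dvd G_cyclic P_generates); case: s1 => ->.
  by rewrite mul1r.
by rewrite mulN1r rpredN.
Qed.

Lemma scale_ptriple_subproof (d : nat) (t : ptriple m) :
  (0 < d)%N -> is_ptriple m (scale_triple d t).
Proof.
move=> d0; have /andP[/eqP e c0] := ptripleP t.
rewrite /is_ptriple /= muln_gt0 d0 c0 !andbT.
by apply/eqP; rewrite PoszM [RHS]exprMn -e; ring.
Qed.

Lemma pm1_mul (s a : int) : (s = 1 \/ s = -1) -> (a = 1 \/ a = -1) ->
  s * a = 1 \/ s * a = -1.
Proof. by case=> ->; case=> ->; [left|right|right|left]. Qed.

(** Outside the first case, (z) = J / conj J with J either the [h j]-th power of [P j] or the ideal
    of the generic construction, so up to one common sign the coordinates are the twists of J. *)
Lemma beta_ord p x : L p -> beta_spec l h P p x ->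
  [/\ forall p', L p' -> p' <> p -> ~ D p' \/ D p -> pyth_ord (l p') x = 0,
      ~ D p -> pyth_ord (l p) x = 1 \/ pyth_ord (l p) x = -1
    & forall j, p = q j -> (1 < h j)%N ->
        pyth_ord (l p) x = (h j)%:Z \/ pyth_ord (l p) x = - (h j)%:Z].
Proof.
move=> Lp; have pp : prime p by case: Lp.
have nec := lifting_conj_neq Lp.
case=> [[L0 b0]|[j [ep [u [v [eJ cl]]]]]|[nL0 nq [t [gt _ cl]]]].
- have [off on] := beta_L0_ord hm sqf lP Lp b0.
  split=> //; first by move=> p' [pp' _] ne _; exact: off.
  by move=> j ep hj; case: (@D_not_L0 p) => //; exists j.
- have [t et xt] := is_class_abs cl; have [s s1 ex] := pyth_ord_abs xt.
  have neP : conj_nzideal (P j) <> P j :> nzideal m.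
    by apply: split_conj_neq; rewrite -ep.
  have ordE p' : pyth_ord (l p') x = s * ((h j)%:Z * twist (l p') (P j)).
    rewrite ex -twistX; congr (_ * _); apply: (triple_ord_square _ _ et).
      by rewrite -expgnA mulnC.
    by rewrite ideal_normX ideal_norm_split // -ep.
  have on : twist (l p) (P j) = 1 \/ twist (l p) (P j) = -1.
    by apply: twist_same_prime => //; rewrite lP // ep.
  split.
  + move=> p' [pp' _] ne _; rewrite ordE twist_prime_neq ?mulr0 // lP //.
    by rewrite -ep.
  (* A prime [q j] outside [D] comes from a trivial factor, so the coordinate, [h j] up to sign, is
     1 or -1. *)
  + move=> nD; rewrite ordE; have h1 : h j = 1%N.
      have := cyclic_order_gt0 G_cyclic j; case: (ltnP 1 (h j)) => [h1|]; last by lia.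
      by case: nD; exists j.
    by rewrite h1 mul1r; exact: pm1_mul.
  + move=> i ei hi; have eij : j = i by apply: generator_below_inj => //; rewrite -ei.
    by rewrite -eij ordE; case: s1 => ->; case: on => ->; [left|right|right|left]; ring.
have nD : ~ D p by move=> [j ep _]; exact: nq ep.
have {cl} [t0 et0 xt] := is_class_abs cl.
have {t0 et0 xt} xt : x = (\pi_(pyth_group m) t)%qT \/ x = - (\pi_(pyth_group m) t)%qT.
  suff -> : t = t0 by [].
  by apply: val_inj; rewrite /= et0; case: (ptriple_val t) => [[]].
have [s s1 ex] := pyth_ord_abs xt.
case: gt => _ [Q [a [u [v [d]]]]]; cbv zeta => -[QP ah _ eJ [d0 ec]].
set J := (_ * _)%g in eJ.
(* Exponents are at most half of [h j], so a nonzero one forces [1 < h j]; then [P j] differs from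
   its conjugate and has norm [q j]. *)
have ah0 j : (a j != 0)%N -> (1 < h j)%N by have := ah j; lia.
have normQ j : (ideal_norm (Q j) ^ a j = q j ^ a j)%N.
  have [->//|/ah0 hj] := eqVneq (a j) 0%N; congr (_ ^ _)%N.
  have nej := generator_conj_neq hj.
  by case: (QP j) => ->; rewrite ?ideal_norm_conj ideal_norm_split.
have normJ : ideal_norm J = (p * \prod_(j < n) q j ^ a j)%N.
  rewrite ideal_normM ideal_norm_split // lP // ideal_norm_prod.
  by congr (_ * _)%N; apply: eq_bigr => j _; rewrite ideal_normX normQ.
have ordE p' : pyth_ord (l p') x
    = s * (twist (l p') (l p) + \sum_(j < n) (a j)%:Z * twist (l p') (Q j)).
  rewrite ex; congr (_ * _).
  (* The triple read off from [J ^+ 2] is [d] times the primitive one, with the same valuations. *)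
  have d0z : d%:Z != 0 by lia.
  rewrite -(triple_ord_scale _ _ d0z).
  have := @triple_ord_square m (l p') J (PTriple (scale_ptriple_subproof t d0)) u v _ eJ.
  move=> /(_ (p * \prod_(j < n) q j ^ a j)%N) /= -> //; last first.
    by rewrite -ec mulnA.
  rewrite twistM twist_prod; congr (_ + _).
  by apply: eq_bigr => j _; rewrite twistX.
have off p' : L p' -> ~ D p' -> \sum_(j < n) (a j)%:Z * twist (l p') (Q j) = 0.
  move=> [pp' _] nD'; rewrite big1 // => j _.
  have [->|/ah0 hj] := eqVneq (a j) 0%N; first by rewrite mul0r.
  suff e0 : twist (l p') (P j) = 0.
    by case: (QP j) => ->; rewrite ?twist_conj e0 ?oppr0 mulr0.
  by apply: twist_prime_neq; rewrite lP // => e; apply: nD'; exists j.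
split.
- move=> p' Lp' ne [nD'|//]; rewrite ordE off // addr0 twist_prime_neq ?mulr0 //.
  by rewrite !lP //; case: Lp'.
- by move=> _; rewrite ordE off // addr0 twist_self // mulr1.
- by move=> j ep; case: (nq j).
Qed.

Lemma beta_basis (beta : nat -> pyth_group m) :
  (forall p, L p -> beta_spec l h P p (beta p)) -> is_basis (beta @` L).
Proof.
move=> betaP.
have bP p (Lp : L p) := beta_ord Lp (betaP p Lp).
apply: (@basis_of_coordinates _ L D (fun p => pyth_ord (l p) : {additive _ -> _})).
- exact: D_split.
- have m0 : (0 < m)%N by lia.
  move=> x; have [B [xB _]] := pyth_ord_relation x m0 lP.
  by exists B => p [pp _]; exact: xB.
- by move=> x; exact: pyth_ord_inj.
- by move=> p Lp; case: (bP p Lp).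
- move=> p Dp; have [_ _ on] := bP p (D_split Dp); case: Dp => j ep hj.
  by case: (on j ep hj) => /= ->; lia.
- by move=> p p' Lp Lp' ne H; have [off _ _] := bP p Lp; exact: off.
- move=> y y0 p Dp; have [_ _ on] := bP p (D_split Dp).
  case: Dp => j ep hj; have := rho_relation y0 hj; rewrite -ep.
  by case: (on j ep hj) => /= -> //; rewrite !dvdzE abszN.
Qed.

End Coordinates.

Theorem theorem2 (m : nat)
    (hm : (3 < m)%N) (m_square_free : square_free m)
    (cl_order : exists (x : class_group m) (k : nat), (2 < k)%N /\ has_order x k)
    (l : nat -> prime_ideal m)
    (lP : forall p : nat, prime p -> prime_below (l p) = p)
    (n : nat) (G : 'I_n -> set (class_group_mod_E m)) (h : 'I_n -> nat)
    (G_product : internal_direct_product G)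
    (G_cyclic : forall j, cyclic_of_order (G j) (h j))
    (P : 'I_n -> prime_ideal m)
    (P_generates : forall j, G j = cycle_of (rho (class_of_ideal (P j))))
    (beta : nat -> pyth_group m)
    (betaP : forall p, split_primes m p -> beta_spec l h P p (beta p)) :
  free_abelian_group (pyth_group m) /\ is_basis (beta @` split_primes m).
Proof.
have B := beta_basis hm m_square_free lP G_product G_cyclic P_generates betaP.
by split=> //; exists (beta @` split_primes m).
Qed.
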